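(* Consider the Joyce structure of the $A_2$ quiver described in the context, and let $\tau|_Y$ be its $\tau$-function restricted to the locus $Y=\{r=0\}$, with the choices of symplectic potentials $\Theta_0=i_E(\Omega_0)+\lambda$ with $\lambda=b\,da$, and $\Theta_1=-(2\pi i)^{-1}x_1\,dx_2$. Then $$d\log(\tau|_Y)=\epsilon^{-2}\left(-\frac{6b}{5}\,da+\frac{4a}{5}\,db+b\,da\right)+\epsilon^{-1}\left(\frac{2q}{5}\,dp-\frac{3p}{5}\,dq\right)+\frac{1}{2\pi i}\,x_1\,dx_2.$$ Moreover, take $\epsilon=\frac12$ and identify variables with those of the Painlevé I $\tau$-function $\tau_{LR}$ (described in the context) via $$q_{LR}=q,\quad p_{LR}=-2p,\quad t=2a,\quad H=2b,\quad x_1=2\pi i\,\nu_1,\quad x_2=-2\pi i\,\nu_2.$$ Then $d\log\tau_{LR}=d\log(\tau|_Y)$, so that the two $\tau$-functions, both well defined up to multiplication by a nonzero constant, coincide.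
   Context: Joyce structure. The base is $M=\{(a,b)\in\mathbb{C}^2: 4a^3+27b^2\ne0\}$. Consider the equations $$f''(x)=Q(x)f(x),\quad Q(x)=\epsilon^{-2}(x^3+ax+b)+\epsilon^{-1}\left(\frac{p}{x-q}+r\right)+\frac{3}{4(x-q)^2}+\frac{r}{2p(x-q)}+\frac{r^2}{4p^2},$$ with $\epsilon\in\mathbb{C}^*$, $(a,b)\in M$, $r\in\mathbb{C}$ and $p^2=q^3+aq+b$ (so that $x=q$ is an apparent singularity: the monodromy around it is trivial in $PGL_2(\mathbb{C})$). Let $(\gamma_1,\gamma_2)$ be a basis of $H_1(\Sigma,\mathbb{Z})$, with intersection $\gamma_1\cdot\gamma_2=1$, for the elliptic curve $\Sigma$ compactifying $y^2=x^3+ax+b$. The functions $z_i=\int_{\gamma_i}y\,dx$ are local co-ordinates on $M$, and with $$\theta_i=-\int_{\gamma_i}\left(\frac{p}{x-q}+r\right)\frac{dx}{2y}$$ the $(z_i,\theta_j)$ give local co-ordinates on $X=T_M$ (tangent vectors written $\sum_i\theta_i\partial/\partial z_i$); thus $(a,b,q,p,r)$ with $p^2=q^3+aq+b$ may be used locally to parameterise $X$. The Joyce structure connections $h_\epsilon$ on $X\to M$ are the isomonodromy connections of the family of equations $f''(x)=Q(x)f(x)$, with $Q(x)=\epsilon^{-2}(x^3+ax+b)+\epsilon^{-1}\left(\frac{p}{x-q}+r\right)+\frac{3}{4(x-q)^2}+\frac{r}{2p(x-q)}+\frac{r^2}{4p^2}$. The Euler vector field is $$E=\frac{4a}{5}\frac{\partial}{\partial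 a}+\frac{6b}{5}\frac{\partial}{\partial b}+\frac{2q}{5}\frac{\partial}{\partial q}+\frac r5\frac{\partial}{\partial r}$$ (and its projection to $M$). The symplectic forms are $\Omega_0=-\frac{1}{2\pi i}dz_1\wedge dz_2=da\wedge db$ on $M$, and $2i\Omega_I=\frac{1}{2\pi i}(d\theta_1\wedge dz_2-d\theta_2\wedge dz_1)=dq\wedge dp+da\wedge dr$ on $X$. Set $\Theta_I=i_E(\Omega_I)$. The twistor fibre $Z_\infty$ (space of leaves of $h_\infty$) has co-ordinates $\phi_1=q+\frac{ar}{p}$, $\phi_2=\frac{r}{2p}$ and symplectic form $\Omega_\infty=d\phi_1\wedge d\phi_2$. One restricts to the inverse image $Y=\{r=0\}\subset X$ of the Lagrangian $R=\{\phi_2=0\}\subset Z_\infty$; it has co-ordinates $(a,q,p)$, with $b=p^2-q^3-aq$. Co-ordinates $x_1,x_2$. For each point of $X$ and $\epsilon\in\mathbb{C}^*$, the equation $f''(x)=Q(x)f(x)$, with $Q(x)=\epsilon^{-2}(x^3+ax+b)+\epsilon^{-1}\left(\frac{p}{x-q}+r\right)+\frac{3}{4(x-q)^2}+\frac{r}{2p(x-q)}+\frac{r^2}{4p^2}$, has 5 Stokes sectors at $x=\infty$, in each of which there is a unique subdominant solution up to scale; this gives 5 cyclically ordered points of the projectivised solution space $\mathbb{P}^1$ (a framed local system on a disc with 5 marked boundary points), constant along leaves of $h_\epsilon$. For a triangulation of the pentagon by two diagonals, the Fock–Goncharov co-ordinates $\exp(x_1),\exp(x_2)$ are the cross-ratios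 of the four points at the vertices of the quadrilateral around each diagonal. Conventions (for ordering of diagonals and cross-ratios) are such that $$-\frac{1}{2\pi i}dx_1\wedge dx_2=\epsilon^{-2}\Omega_0+2i\epsilon^{-1}\Omega_I+\Omega_\infty$$ on $X$ for fixed $\epsilon$ (pullbacks omitted). The functions $x_1,x_2$ are considered locally, with fixed branches of logarithms. Joyce structure $\tau$-function. In general $d\log(\tau)=\epsilon^{-2}\Theta_0+2i\epsilon^{-1}\Theta_I+\Theta_\infty-\Theta_1$ (pullbacks omitted, $\epsilon$ fixed) where $d\Theta_0=\Omega_0$, $d\Theta_\infty=\Omega_\infty$ and $d\Theta_1=-\frac{1}{2\pi i}dx_1\wedge dx_2$. Restricting to $Y$, where $\Omega_\infty$ vanishes, one drops $\Theta_\infty$, so that $\tau|_Y$ is the locally-defined function on $Y$, unique up to a multiplicative constant, with $$d\log(\tau|_Y)=\left.\left(\epsilon^{-2}\Theta_0+2i\epsilon^{-1}\Theta_I-\Theta_1\right)\right|_Y.$$ Painlevé I $\tau$-function (Lisovyy–Roussillon). Here $q,p,t$ denote the Painlevé I variables $q_{LR},p_{LR},t$, subscript $t$ is the derivative along the Painlevé I flow, with $q_t=p$, $p_t=6q^2+t$, and $H=\frac{p^2}{2}-2q^3-tq$, so $H_t=-q$. The 1-form $\omega$ in the variables $t,q,p$ is defined by $$\frac{\omega}{2}=H\,dt+\frac15\left(4t\,dH+3q_t\,dq-2q\,dq_t-(4tH_t+3q_t^2-2q\,q_{tt})\,dt\right).$$ There are monodromy co-ordinates $\nu_1,\nu_2$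 (local functions of $(t,q,p)$, constant along the Painlevé I flow, logarithms of Stokes data of the linear system associated to Painlevé I, which is gauge equivalent to the equation $f''(x)=Q(x)f(x)$ defining the Joyce structure, taken with $r=0$, $\epsilon=\frac12$, that is with $Q(x)=4(x^3+ax+b)+\frac{2p}{x-q}+\frac{3}{4(x-q)^2}$ where $p,q$ are here the Joyce structure variables, under the identification of variables in the claim) such that $d\omega=4\pi i\,d\nu_1\wedge d\nu_2$. They are matched with the Fock–Goncharov co-ordinates by $x_1=2\pi i\nu_1$, $x_2=-2\pi i\nu_2$. The $\tau$-function $\tau_{LR}$ is the locally-defined function, unique up to a multiplicative constant, satisfying $$d\log(\tau_{LR})=\frac12\omega-2\pi i\,\nu_1\,d\nu_2.$$ *)

(* Defs.v *)
From HB Require Import structures.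
From mathcomp Require Import all_boot all_order all_algebra.
From mathcomp Require Import all_classical all_reals all_analysis.
From mathcomp Require Import complex.
Set Implicit Arguments.
Unset Strict Implicit.
Unset Printing Implicit Defensive.
Import Order.TTheory GRing.Theory Num.Theory.
Import numFieldNormedType.Exports.
Local Open Scope classical_set_scope.
Local Open Scope ring_scope.

(* Using the numClosedFieldType structure of R[i], instead of the bare type, is
   what makes its topology and the C-linear differential 'd of derive.v
   available: neither is declared on R[i] itself. *)
Definition cplx (R : realType) : numClosedFieldType := R[i].

Section Complex.
Variable R : realType.
Local Notation C := (cplx R).

Definition expC (z : C) : C :=
  let: Complex x y := z in Complex (expR x * cos y) (expR x * sin y).

Definition realC (x : R) : C := Complex x 0.

Definition twopii : C := 2 * realC pi * 'i.

Definition vec n (s : seq C) : 'rV[C]_n := \row_(k < n) s`_k.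

End Complex.

(* Holomorphic differential forms on open subsets of C^n, as functions of a base
   point and of tangent vectors. *)
Section Forms.
Variable R : realType.
Local Notation C := (cplx R).

Definition form1 n := 'rV[C]_n -> 'rV[C]_n -> C.
Definition form2 n := 'rV[C]_n -> 'rV[C]_n -> 'rV[C]_n -> C.

Definition wedge n (al be : form1 n) : form2 n :=
  fun x v w => al x v * be x w - al x w * be x v.

Definition diff0 n (f : 'rV[C]_n -> C) : form1 n := fun x v => 'd f x v.

Definition diff1 n (al : form1 n) : form2 n :=
  fun x v w => 'd (fun y => al y w) x v - 'd (fun y => al y v) x w.

Definition contract n (X : 'rV[C]_n -> 'rV[C]_n) (om : form2 n) : form1 n :=
  fun x v => om x (X x) v.

Definition pull1 m n (phi : 'rV[C]_m -> 'rV[C]_n) (al : form1 n) : form1 m :=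
  fun x v => al (phi x) ('d phi x v).

Definition pull2 m n (phi : 'rV[C]_m -> 'rV[C]_n) (om : form2 n) : form2 m :=
  fun x v w => om (phi x) ('d phi x v) ('d phi x w).

Definition dlog n (f : 'rV[C]_n -> C) : form1 n := fun x v => diff0 f x v / f x.

(* Holomorphic functions on an open set, with all iterated derivatives.  Only
   the first order is a real condition: by Cauchy's theorem (not in the
   library) complex differentiability on an open set gives the others. *)
Fixpoint holomorphic_upto k n (U : set 'rV[C]_n) (f : 'rV[C]_n -> C) : Prop :=
  (forall x, U x -> differentiable f x) /\
  (if k is k'.+1 then forall v, holomorphic_upto k' U (fun x => diff0 f x v)
   else True).

Definition holomorphic n (U : set 'rV[C]_n) (f : 'rV[C]_n -> C) : Prop :=
  forall k, holomorphic_upto k U f.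

(* [P V tau] reads: tau is a tau-function on V.  The predicate says that P
   defines, near every point of D, a function unique up to a non-zero
   multiplicative constant. *)
Definition defined_up_to_constant n (D : set 'rV[C]_n)
    (P : set 'rV[C]_n -> ('rV[C]_n -> C) -> Prop) : Prop :=
  (forall y, D y -> exists V tau, [/\ V y, connected V & P V tau]) /\
  (forall V tau tau', connected V -> P V tau -> P V tau' ->
     exists2 c : C, c != 0 & forall y, V y -> tau' y = c * tau y).

End Forms.

(* The Joyce structure.  M has co-ordinates (a,b).  X is given by its global
   co-ordinates (a,q,p,r), in which b = p^2 - q^3 - a q; the points with p = 0,
   where the potential Q is undefined, are excluded.  Y has co-ordinates
   (a,q,p). *)
Section Joyce.
Variable R : realType.
Local Notation C := (cplx R).

Definition aM (m : 'rV[C]_2) : C := m 0 0.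
Definition bM (m : 'rV[C]_2) : C := m 0 1.

Definition Mset : set 'rV[C]_2 :=
  [set m | 4 * aM m ^+ 3 + 27 * bM m ^+ 2 != 0].

Definition aX (x : 'rV[C]_4) : C := x 0 0.
Definition qX (x : 'rV[C]_4) : C := x 0 1.
Definition pX (x : 'rV[C]_4) : C := x 0 2.
Definition rX (x : 'rV[C]_4) : C := x 0 3.
Definition bX (x : 'rV[C]_4) : C := pX x ^+ 2 - qX x ^+ 3 - aX x * qX x.

Definition projM (x : 'rV[C]_4) : 'rV[C]_2 := vec 2 [:: aX x; bX x].

Definition Xset : set 'rV[C]_4 := [set x | Mset (projM x) /\ pX x != 0].

Definition aY (y : 'rV[C]_3) : C := y 0 0.
Definition qY (y : 'rV[C]_3) : C := y 0 1.
Definition pY (y : 'rV[C]_3) : C := y 0 2.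

Definition incY (y : 'rV[C]_3) : 'rV[C]_4 := vec 4 [:: aY y; qY y; pY y; 0].

Definition bY (y : 'rV[C]_3) : C := bX (incY y).

(* The component of the Euler field along p is forced by tangency to
   p^2 = q^3 + a q + b, i.e. by 2 p dp = (3 q^2 + a) dq + q da + db. *)
Definition eulerX (x : 'rV[C]_4) : 'rV[C]_4 :=
  let Ea := 4 * aX x / 5 in
  let Eb := 6 * bX x / 5 in
  let Eq := 2 * qX x / 5 in
  let Er := rX x / 5 in
  let Ep := ((3 * qX x ^+ 2 + aX x) * Eq + qX x * Ea + Eb) / (2 * pX x) in
  vec 4 [:: Ea; Eq; Ep; Er].

Definition eulerM (m : 'rV[C]_2) : 'rV[C]_2 :=
  vec 2 [:: 4 * aM m / 5; 6 * bM m / 5].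

Definition Omega0 : form2 R 2 := wedge (diff0 aM) (diff0 bM).

Definition OmegaI : form2 R 4 := fun x v w =>
  (2 * 'i)^-1 * (wedge (diff0 qX) (diff0 pX) x v w
                 + wedge (diff0 aX) (diff0 rX) x v w).

Definition OmegaInf : form2 R 4 :=
  wedge (diff0 (fun x => qX x + aX x * rX x / pX x))
        (diff0 (fun x => rX x / (2 * pX x))).

Definition Theta0 : form1 R 2 := fun m v =>
  contract eulerM Omega0 m v + bM m * diff0 aM m v.

Definition ThetaI : form1 R 4 := contract eulerX OmegaI.

Definition Theta1 (x1 x2 : 'rV[C]_4 -> C) : form1 R 4 := fun x v =>
  - (twopii R)^-1 * (x1 x * diff0 x2 x v).

Definition potential (eps : C) (m : 'rV[C]_4) (x : C) : C :=
  let a := aX m in let b := bX m in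
  let q := qX m in let p := pX m in let r := rX m in
  eps ^- 2 * (x ^+ 3 + a * x + b) + eps^-1 * (p / (x - q) + r)
  + 3 / (4 * (x - q) ^+ 2) + r / (2 * p * (x - q)) + r ^+ 2 / (4 * p ^+ 2).

(* Solutions of f'' = Q f are double-valued: the monodromy around the apparent
   singularity x = q (exponents 3/2 and -1/2) is -1.  A solution is therefore
   recorded by the single-valued function g on C \ {q} such that
   f = g / sqrt(x - q), for every local branch s of sqrt(x - q). *)
Definition is_solution (Q : C -> C) (q : C) (g : C -> C) : Prop :=
  forall (V : set C) (s : C -> C), open V ->
    (forall x, V x -> x != q /\ {for x, continuous s} /\ s x ^+ 2 = x - q) ->
    let f := fun x => g x / s x in
    forall x, V x ->
      [/\ derivable f x 1, derivable (derive1 f) x 1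
        & derive1 (derive1 f) x = Q x * f x].

(* The k-th Stokes sector at infinity, where eps = |eps| exp(i eta): the
   directions at angle less than pi/5 from the k-th of the five rays on which
   eps^-2 x^5 > 0. *)
Definition stokes_sector (eta : R) (k : 'I_5) : set R :=
  [set th | `| th - (2 * eta + 2 * pi * k%:R) / 5 | < pi / 5].

(* f -> 0 in the sector, written for f^2 = g^2 / (x - q). *)
Definition subdominant (q : C) (eta : R) (k : 'I_5) (g : C -> C) : Prop :=
  forall th, stokes_sector eta k th ->
    let ray t := realC t * Complex (cos th) (sin th) in
    (fun t : R => g (ray t) ^+ 2 / (ray t - q)) @ +oo%R --> (0 : C).

(* [z k] are homogeneous co-ordinates, with respect to a basis (u, v) of the
   solution space, of the point of P^1 given by the k-th subdominant line. *)
Definition framing (eps : C) (eta : R) (m : 'rV[C]_4) (z : 'I_5 -> C * C) :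
    Prop :=
  exists u v : C -> C,
    [/\ is_solution (potential eps m) (qX m) u,
        is_solution (potential eps m) (qX m) v,
        forall al be : C,
          (forall x, x != qX m -> al * u x + be * v x = 0) -> al = 0 /\ be = 0
      & forall k, z k != 0 /\
          subdominant (qX m) eta k (fun x => (z k).1 * u x + (z k).2 * v x)].

Definition det2 (z w : C * C) : C := z.1 * w.2 - z.2 * w.1.

(* (z1-z2)(z3-z4) / ((z1-z4)(z2-z3)), in homogeneous co-ordinates. *)
Definition cross_ratio (z1 z2 z3 z4 : C * C) : C :=
  (det2 z1 z2 * det2 z3 z4) / (det2 z1 z4 * det2 z2 z3).

(* The co-ordinate of a diagonal with endpoints z1, z3; listing the vertices
   from z2 instead inverts the cross-ratio, and [inv] chooses between these two
   conventions. *)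
Definition diagonal_coord (inv : bool) (z1 z2 z3 z4 : C * C) : C :=
  if inv then (cross_ratio z1 z2 z3 z4)^-1 else cross_ratio z1 z2 z3 z4.

(* A triangulation of the pentagon consists of the diagonals (j,j+2), (j,j+3)
   from some vertex j; [swap] chooses which one comes first. *)
Definition fock_goncharov (inv swap : bool) (j : 'I_5) (z : 'I_5 -> C * C) :
    C * C :=
  let X := diagonal_coord inv (z j) (z (j + 1)) (z (j + 2)) (z (j + 3)) in
  let X' := diagonal_coord inv (z j) (z (j + 2)) (z (j + 3)) (z (j + 4)) in
  if swap then (X', X) else (X, X').

(* x1, x2 are logarithmic Fock-Goncharov co-ordinates on the open set N of X,
   for a choice of the conventions for which the symplectic identity holds. *)
Definition fg_coordinates (eps : C) (N : set 'rV[C]_4)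
    (x1 x2 : 'rV[C]_4 -> C) : Prop :=
  [/\ open N, N `<=` Xset, holomorphic N x1, holomorphic N x2 &
   (exists eta : R, exists inv swap : bool, exists j : 'I_5,
     eps = `|eps| * Complex (cos eta) (sin eta) /\
     forall m, N m -> exists2 z : 'I_5 -> C * C, framing eps eta m z &
       (expC (x1 m), expC (x2 m)) = fock_goncharov inv swap j z)
   /\
   forall m, N m -> forall v w,
     - (twopii R)^-1 * wedge (diff0 x1) (diff0 x2) m v w
     = eps ^- 2 * pull2 projM Omega0 m v w + 2 * 'i * eps^-1 * OmegaI m v w
       + OmegaInf m v w].

Definition tau_form (eps : C) (Th0 : form1 R 2) (ThI Th1 : form1 R 4) :
    form1 R 4 := fun x v =>
  eps ^- 2 * pull1 projM Th0 x v + 2 * 'i * eps^-1 * ThI x v - Th1 x v.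

Definition is_tauY (eps : C) (N : set 'rV[C]_4) (Th0 : form1 R 2)
    (ThI Th1 : form1 R 4) (V : set 'rV[C]_3) (tau : 'rV[C]_3 -> C) : Prop :=
  [/\ open V, V `<=` incY @^-1` N, holomorphic V tau,
      forall y, V y -> tau y != 0
    & forall y, V y -> forall v,
        dlog tau y v = pull1 incY (tau_form eps Th0 ThI Th1) y v].

End Joyce.

(* Here 'rV_3 carries the Painleve I variables (t,q,p). *)
Section Painleve.
Variable R : realType.
Local Notation C := (cplx R).

Definition tL (y : 'rV[C]_3) : C := y 0 0.
Definition qL (y : 'rV[C]_3) : C := y 0 1.
Definition pL (y : 'rV[C]_3) : C := y 0 2.

Definition flowL (y : 'rV[C]_3) : 'rV[C]_3 :=
  vec 3 [:: 1; pL y; 6 * qL y ^+ 2 + tL y].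

(* The derivative f_t along the flow q_t = p, p_t = 6 q^2 + t. *)
Definition dt (f : 'rV[C]_3 -> C) (y : 'rV[C]_3) : C := diff0 f y (flowL y).

Definition HL (y : 'rV[C]_3) : C :=
  pL y ^+ 2 / 2 - 2 * qL y ^+ 3 - tL y * qL y.

Definition omegaL : form1 R 3 := fun y v =>
  2 * (HL y * diff0 tL y v
       + 5^-1 * (4 * tL y * diff0 HL y v + 3 * dt qL y * diff0 qL y v
                 - 2 * qL y * diff0 (dt qL) y v
                 - (4 * tL y * dt HL y + 3 * dt qL y ^+ 2
                    - 2 * qL y * dt (dt qL) y) * diff0 tL y v)).

Definition monodromy_coordinates (L : set 'rV[C]_3)
    (nu1 nu2 : 'rV[C]_3 -> C) : Prop :=
  [/\ open L, holomorphic L nu1, holomorphic L nu2,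
      forall y, L y -> dt nu1 y = 0 /\ dt nu2 y = 0
    & forall y, L y -> forall v w,
        diff1 omegaL y v w = 2 * twopii R * wedge (diff0 nu1) (diff0 nu2) y v w].

Definition is_tauL (L : set 'rV[C]_3) (nu1 nu2 : 'rV[C]_3 -> C)
    (W : set 'rV[C]_3) (tau : 'rV[C]_3 -> C) : Prop :=
  [/\ open W, W `<=` L, holomorphic W tau, forall y, W y -> tau y != 0
    & forall y, W y -> forall v,
        dlog tau y v = 2^-1 * omegaL y v - twopii R * nu1 y * diff0 nu2 y v].

(* The identification (a,q,p) |-> (t,q_LR,p_LR) = (2a, q, -2p). *)
Definition identL (y : 'rV[C]_3) : 'rV[C]_3 :=
  vec 3 [:: 2 * aY y; qY y; - (2 * pY y)].

(* x1 = 2 pi i nu1 and x2 = - 2 pi i nu2 under this identification: this is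
   what makes nu1, nu2 logarithms of Stokes data. *)
Definition matched (N : set 'rV[C]_4) (x1 x2 : 'rV[C]_4 -> C)
    (L : set 'rV[C]_3) (nu1 nu2 : 'rV[C]_3 -> C) : Prop :=
  forall y, N (incY y) -> L (identL y) ->
    x1 (incY y) = twopii R * nu1 (identL y) /\
    x2 (incY y) = - (twopii R * nu2 (identL y)).

End Painleve.

(* Main.v *)
Require Import Defs.
From HB Require Import structures.
From mathcomp Require Import all_boot all_order all_algebra.
From mathcomp Require Import all_classical all_reals all_analysis.
From mathcomp Require Import complex.
From mathcomp Require Import ring.
Set Implicit Arguments.
Unset Strict Implicit.
Unset Printing Implicit Defensive.
Import Order.TTheory GRing.Theory Num.Theory.
Import numFieldNormedType.Exports.
Local Open Scope classical_set_scope.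
Local Open Scope ring_scope.

(** All the assertions are about the two 1-forms whose local logarithmic primitives are the
    tau-functions.

    On Y = (r = 0), with co-ordinates (a, q, p) and b = p^2 - q^3 - a q, the form
    eps^-2 Theta_0 + 2 i eps^-1 Theta_I - Theta_1 is computed by contracting with the Euler field
    (lemma [tau_formE]). It is closed ([formY_closed]): its exterior derivative is the
    difference of the two sides of the symplectic identity satisfied by x1 and x2, because
    Omega_infinity vanishes on Y. The form defining the Painleve I tau-function is closed by the
    normalisation of the monodromy co-ordinates ([formL_closed]); explicitly, using H_t = -q,
    its polynomial part is that of [omegaLE]. Substituting (t, q_LR, p_LR) = (2 a, q, -2 p)
    turns this polynomial part into the one of the form on Y at eps = 1/2 ([omegaL_identL]),
    and the matching of co-ordinates identifies the remaining terms, so the two forms coincide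
    ([dlog_tau_eq]).

    A closed holomorphic 1-form is locally dlog of a holomorphic function that is unique up to a
    constant factor on connected open sets ([exists_dlog_primitive], [dlog_unique]). This rests
    on the Poincare lemma ([poincare]), on the complex exponential being its own derivative
    ([expC_diff]) and, for the closedness of exact forms, on the symmetry of second derivatives
    ([schwarz]). These are proved for complex differentiability by restricting functions to real
    segments, where the real mean value theorem and the fundamental theorem of calculus apply to
    real and imaginary parts; the bounds on second derivatives that they use come with the
    definition of [holomorphic]. *)

(** * Complex-valued functions of a real variable *)

Section Epsilon.
Variables (K : numFieldType) (V W : normedModType K).

(** Epsilon-delta forms of differentiability: [diff_approx] to use it, [approx_diff]
    to establish it together with the value of the differential. *)
Lemma diff_approx (f : V -> W) x : differentiable f x ->
  forall e : K, 0 < e -> exists2 d : K, 0 < d & forall h, `|h| < d ->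
    `|f (x + h) - f x - 'd f x h| <= e * `|h|.
Proof.
move=> df e e0; have /diff_locallyP[_ /eqaddoP/(_ _ e0)] := df.
move=> /nbhs_normP[d /= d0 H]; exists d => // h hd.
have := H h; rewrite /= sub0r normrN => /(_ hd).
by rewrite !fctE /= opprD addrA (addrC h).
Qed.

Lemma approx_diff (f : V -> W) (L : {linear V -> W}) x : continuous L ->
  (forall e : K, 0 < e -> exists2 d : K, 0 < d & forall h, `|h| < d ->
    `|f (x + h) - f x - L h| <= e * `|h|) ->
  differentiable f x /\ 'd f x = L :> (V -> W).
Proof.
move=> Lc H.
have E : f \o shift x = cst (f x) + (L : V -> W) +o_ 0 id.
  apply/eqaddoP => e e0; have [d d0 Hd] := H e e0.
  apply/nbhs_normP; exists d => //= h; rewrite /= sub0r normrN => /Hd.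
  by rewrite !fctE /= opprD addrA (addrC h).
have dE := diff_unique Lc E.
by split=> //; apply/diff_locallyP; rewrite dE.
Qed.

End Epsilon.

Section RealPaths.
Variable R : realType.
Local Notation C := (cplx R).
Local Notation ReC := (@complex.Re R : C -> R).
Local Notation ImC := (@complex.Im R : C -> R).

(** The derivative of a complex-valued function of a real variable, through real and
    imaginary parts so that theorems of real analysis apply to it. *)
Definition path_derive (f : R -> C) (t : R) (d : C) : Prop :=
  is_derive t 1 (ReC \o f) (ReC d) /\ is_derive t 1 (ImC \o f) (ImC d).

Lemma approx_derive (f : R -> R) t d :
  (forall e : R, 0 < e -> exists2 r : R, 0 < r & forall h, `|h| < r ->
    `|f (t + h) - f t - h * d| <= e * `|h|) -> is_derive t 1 f d.
Proof.
move=> H.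
have lin : linear (fun h : R => h * d : R) by move=> a u v; rewrite mulrDl scalerAl.
pose M := GRing.isLinear.Build _ _ _ _ _ lin.
pose L : {linear R -> R} := HB.pack (fun h : R => h * d : R) M.
have Lc : continuous L by move=> u; exact: mulrr_continuous.
have [df dE] := approx_diff Lc H.
split; first exact/derivable1_diffP.
by rewrite deriveE // dE /= mul1r.
Qed.

Lemma realCD : {morph @realC R : x y / x + y >-> x + y : C}.
Proof. exact: (rmorphD (real_complex R)). Qed.

Lemma realCM : {morph @realC R : x y / x * y >-> x * y : C}.
Proof. exact: (rmorphM (real_complex R)). Qed.

Lemma ReB (z w : C) : ReC (z - w) = ReC z - ReC w.
Proof. by case: z w => [? ?] [? ?]. Qed.

Lemma ImB (z w : C) : ImC (z - w) = ImC z - ImC w.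
Proof. by case: z w => [? ?] [? ?]. Qed.

Lemma ReZ (t : R) (z : C) : ReC (realC t * z) = t * ReC z.
Proof. by case: z => x y /=; rewrite mul0r subr0. Qed.

Lemma ImZ (t : R) (z : C) : ImC (realC t * z) = t * ImC z.
Proof. by case: z => x y /=; rewrite mul0r addr0. Qed.

Lemma le_realC (x y : R) : ((realC x : C) <= realC y) = (x <= y).
Proof. exact: lecR. Qed.

Lemma lt_realC (x y : R) : ((realC x : C) < realC y) = (x < y).
Proof. exact: ltcR. Qed.

Lemma realC_ge0 (x : R) : ((0 : C) <= realC x) = (0 <= x).
Proof. exact: (le_realC 0). Qed.

Lemma realC_gt0 (x : R) : ((0 : C) < realC x) = (0 < x).
Proof. exact: (lt_realC 0). Qed.

Lemma norm_realC (x : R) : `|realC x : C| = realC `|x|.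
Proof. by rewrite normc_def /= expr0n /= addr0 sqrtr_sqr. Qed.

Lemma pos_realC (e : C) : 0 < e -> e = realC (ReC e) /\ 0 < ReC e.
Proof.
move=> e0; have E : e = realC (ReC e) by rewrite -[LHS](RRe_real (gtr0_real e0)).
by split=> //; move: e0; rewrite [X in 0 < X]E realC_gt0.
Qed.

Lemma nneg_realC (e : C) : 0 <= e -> e = realC (ReC e) /\ 0 <= ReC e.
Proof.
move=> e0; have E : e = realC (ReC e) by rewrite -[LHS](RRe_real (ger0_real e0)).
by split=> //; move: e0; rewrite [X in 0 <= X]E realC_ge0.
Qed.

Lemma Re_le_norm (z : C) (M : R) : `|z| <= realC M -> `|ReC z| <= M.
Proof. by move=> h; rewrite -le_realC (le_trans _ h)// normc_ge_Re. Qed.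

Lemma Im_le_norm (z : C) (M : R) : `|z| <= realC M -> `|ImC z| <= M.
Proof.
move=> h; rewrite -normrN -ReiNIm; apply: Re_le_norm.
by rewrite normrM complexiE normCi mulr1.
Qed.

Lemma norm_le_ReIm (z : C) : `|z| <= realC (`|ReC z| + `|ImC z|).
Proof.
rewrite {1}(complexE z); apply: le_trans (ler_normD _ _) _.
by rewrite normrM complexiE normCi mul1r !norm_realC -realCD.
Qed.

Lemma realC_lt_Re (x : R) (d : C) : 0 < d -> x < ReC d -> (realC x : C) < d.
Proof. by move=> /pos_realC[dE _]; rewrite [X in _ -> _ < X]dE lt_realC. Qed.

Section Lines.
Variable V : normedModType C.

Definition line (x v : V) (t : R) : V := x + realC t *: v.

Lemma line0 (x v : V) : line x v 0 = x.
Proof. by rewrite /line scale0r addr0. Qed.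

Lemma line1 (x v : V) : line x v 1 = x + v.
Proof. by rewrite /line scale1r. Qed.

Lemma lineD (x v h : V) (t : R) : line x (v + h) t = line (line x v t) h t.
Proof. by rewrite /line scalerDr addrA. Qed.

Lemma lineB (x v : V) (t : R) : line x v t - x = realC t *: v.
Proof. by rewrite /line addrAC subrr add0r. Qed.

Lemma norm_line_le (x v : V) (t : R) : 0 <= t <= 1 -> `|line x v t - x| <= `|v|.
Proof.
move=> /andP[t0 t1]; rewrite lineB normrZ norm_realC (ger0_norm t0).
by rewrite -[leRHS]mul1r ler_wpM2r // (le_realC _ 1).
Qed.

Lemma path_derive_line (g : V -> C) (x v : V) (t : R) :
  differentiable g (line x v t) ->
  path_derive (fun s => g (line x v s)) t ('d g (line x v t) v).
Proof.
rewrite /line => dg.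
have key (e : R) : 0 < e -> exists2 r : R, 0 < r & forall h : R, `|h| < r ->
    `|g (x + realC (t + h) *: v) - g (x + realC t *: v)
      - realC h * 'd g (x + realC t *: v) v| <= realC (e * `|h|).
  move=> e0.
  have w0 : 0 < 1 + `|v| :> C by apply: ltr_pwDl.
  have [|d d0 H] := diff_approx dg (e := realC e / (1 + `|v|)).
    by rewrite divr_gt0 // realC_gt0.
  have q0 : 0 < d / (1 + `|v|) by rewrite divr_gt0.
  have [qE Rq0] := pos_realC q0.
  exists (ReC (d / (1 + `|v|))) => // h hr.
  have hv : `|realC h *: v| <= realC `|h| * (1 + `|v|).
    by rewrite normrZ norm_realC ler_wpM2l ?lerDr // realC_ge0.
  have /H : `|realC h *: v| < d.
    by rewrite (le_lt_trans hv)// -ltr_pdivlMr// realC_lt_Re.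
  rewrite realCD scalerDl addrA linearZ /= => /le_trans; apply.
  rewrite realCM -mulrA ler_wpM2l ?realC_ge0 ?(ltW e0)//.
  by rewrite mulrC ler_pdivrMr.
split; apply: approx_derive => e e0; have [r r0 H] := key e e0;
  exists r => // h /H /=.
  by move=> /Re_le_norm; rewrite !ReB ReZ.
by move=> /Im_le_norm; rewrite !ImB ImZ.
Qed.

End Lines.

Lemma path_deriveB f g t c d : path_derive f t c -> path_derive g t d ->
  path_derive (fun s => f s - g s) t (c - d).
Proof.
move=> [fr fi] [gr gi]; split.
  have -> : ReC \o (fun s => f s - g s) = (ReC \o f) - (ReC \o g).
    by apply/funext => s; rewrite /= ReB.
  by rewrite ReB; apply: is_deriveB.
have -> : ImC \o (fun s => f s - g s) = (ImC \o f) - (ImC \o g).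
  by apply/funext => s; rewrite /= ImB.
by rewrite ImB; apply: is_deriveB.
Qed.

Lemma is_derive_mulr (t d : R) : is_derive t 1 (fun s : R => s * d) d.
Proof.
apply: approx_derive => e e0; exists 1 => // h _.
by rewrite mulrDl addrAC addrK subrr normr0 mulr_ge0 // ltW.
Qed.

Lemma path_derive_linear (c : C) t : path_derive (fun s => realC s * c) t c.
Proof.
split.
  have -> : ReC \o (fun s => realC s * c) = (fun s => s * ReC c).
    by apply/funext => s; rewrite /= ReZ.
  exact: is_derive_mulr.
have -> : ImC \o (fun s => realC s * c) = (fun s => s * ImC c).
  by apply/funext => s; rewrite /= ImZ.
exact: is_derive_mulr.
Qed.

Lemma mean_value_real (f df : R -> R) (M : R) :
  (forall t : R, 0 <= t <= 1 -> is_derive t 1 f (df t)) ->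
  (forall t : R, 0 <= t <= 1 -> `|df t| <= M) -> `|f 1 - f 0| <= M.
Proof.
move=> fd dM; have [||c c01 ->] := @MVT R f df 0 1 ltr01.
- move=> t; rewrite in_itv /= => /andP[t0 t1]; apply: fd.
  by rewrite !ltW.
- apply: derivable_within_continuous => t; rewrite in_itv /= => t01.
  by have [] := fd t t01.
- rewrite subr0 mulr1; apply: dM; move: c01; rewrite in_itv /= => /andP[? ?].
  by rewrite !ltW.
Qed.

(** The mean value theorem fails for complex-valued functions; applied separately to real
    and imaginary parts it still gives this inequality, at the price of a factor 2. *)
Lemma mean_value (f df : R -> C) (M : C) :
  (forall t : R, 0 <= t <= 1 -> path_derive f t (df t)) ->
  (forall t : R, 0 <= t <= 1 -> `|df t| <= M) -> `|f 1 - f 0| <= 2 * M.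
Proof.
move=> fd dM.
have [ME M0] : M = realC (ReC M) /\ 0 <= ReC M.
  by apply: nneg_realC; apply: le_trans (dM 0 _); rewrite // lexx ler01.
apply: (le_trans (norm_le_ReIm _)).
rewrite {1}ME mulr_natl mulr2n -realCD le_realC ReB ImB lerD //.
  apply: (@mean_value_real (ReC \o f) (ReC \o df)) => t t01.
    by have [] := fd t t01.
  by apply: Re_le_norm; rewrite -ME; apply: dM.
apply: (@mean_value_real (ImC \o f) (ImC \o df)) => t t01.
  by have [] := fd t t01.
by apply: Im_le_norm; rewrite -ME; apply: dM.
Qed.

(** With [c = 0] this is the mean value inequality on a segment; with [c] the value of the
    differential at an endpoint it bounds the first-order Taylor remainder by the oscillation
    of the differential. *)
Lemma mean_value_taylor (V : normedModType C) (g : V -> C) (x v : V) (c M : C) :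
  (forall t : R, 0 <= t <= 1 ->
     differentiable g (line x v t) /\ `|'d g (line x v t) v - c| <= M) ->
  `|g (x + v) - g x - c| <= 2 * M.
Proof.
move=> H.
have := @mean_value (fun t => g (line x v t) - realC t * c)
  (fun t => 'd g (line x v t) v - c) M.
rewrite line1 line0 mul1r mul0r subr0 addrAC; apply=> t /H[dg //].
by move=> _; apply: path_deriveB; [exact: path_derive_line|exact: path_derive_linear].
Qed.

Lemma mean_value_line (V : normedModType C) (g : V -> C) (x v : V) (M : C) :
  (forall t : R, 0 <= t <= 1 ->
     differentiable g (line x v t) /\ `|'d g (line x v t) v| <= M) ->
  `|g (x + v) - g x| <= 2 * M.
Proof.
move=> H; rewrite -[X in `|X|]subr0; apply: mean_value_taylor => t /H.
by rewrite subr0.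
Qed.

End RealPaths.

(** * Linear maps, balls and connectedness *)

Section LinearAlgebra.
Variable K : numFieldType.

(** Forms are linear in the tangent vector only as functions, so linearity is a hypothesis
    on a plain function here. *)
Lemma linear_rV_expand (W : lmodType K) n (f : 'rV[K]_n -> W) :
  linear f -> forall v, f v = \sum_(i < n) v 0 i *: f (delta_mx 0 i).
Proof.
move=> lf v; pose M := GRing.isLinear.Build _ _ _ _ f lf.
pose F : {linear 'rV[K]_n -> W} := HB.pack f M.
rewrite -[f]/(F : _ -> _) {1}(row_sum_delta v) linear_sum.
by apply: eq_bigr => i _; rewrite linearZ.
Qed.

Lemma linear_rV_continuous (W : normedModType K) n (f : 'rV[K]_n -> W) :
  linear f -> continuous f.
Proof.
move=> lf x; apply: differentiable_continuous.
have -> : f = \sum_(i < n) (fun v : 'rV[K]_n => v 0 i *: f (delta_mx 0 i)).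
  by apply/funext => v; rewrite fct_sumE; exact: linear_rV_expand.
apply: differentiable_sum => i; apply: differentiableZl.
exact: differentiable_coord.
Qed.

Lemma linear_is_diff (W : normedModType K) n (f : 'rV[K]_n -> W) x :
  linear f -> differentiable f x /\ 'd f x = f :> (_ -> _).
Proof.
move=> lf; pose M := GRing.isLinear.Build _ _ _ _ f lf.
pose F : {linear 'rV[K]_n -> W} := HB.pack f M.
have Fc : continuous F by exact: linear_rV_continuous.
by split; [exact: (linear_differentiable (f := F))|exact: (diff_lin (f := F))].
Qed.

Lemma coord_le_norm n (v : 'rV[K]_n) i : `|v 0 i| <= `|v|.
Proof.
rewrite [leRHS]/Num.Def.normr /= mx_normE [leLHS]nngE num_le.
exact: (le_bigmax _ (fun ij => `|v ij.1 ij.2|%:nng) (0, i)).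
Qed.

Lemma norm_lincomb_le n (v : 'rV[K]_n) (c : 'I_n -> K) M :
  (forall i, `|c i| <= M) -> `|\sum_(i < n) v 0 i * c i| <= n%:R * M * `|v|.
Proof.
move=> cM; apply: (le_trans (ler_norm_sum _ _ _)).
have -> : n%:R * M * `|v| = \sum_(i < n) `|v| * M.
  by rewrite sumr_const card_ord -mulrA mulr_natl (mulrC M).
by apply: ler_sum => i _; rewrite normrM ler_pM // coord_le_norm.
Qed.

(** A substitute for the minimum: the scalars need not be totally ordered. *)
Lemma exists_common_bound (a b : K) : 0 < a -> 0 < b ->
  exists2 m : K, 0 < m & m <= a /\ m <= b.
Proof.
move=> a0 b0; have ab : 0 < a + b by rewrite addr_gt0.
exists (a * b / (a + b)); first by rewrite divr_gt0 ?mulr_gt0.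
split; rewrite ler_pdivrMr //.
  by rewrite ler_pM2l // lerDr ltW.
by rewrite mulrC ler_pM2l // lerDl ltW.
Qed.

Lemma diff_near_eq (V W : normedModType K) (f g : V -> W) x :
  (\forall y \near x, f y = g y) -> differentiable f x ->
  differentiable g x /\ 'd g x = 'd f x :> (V -> W).
Proof.
move=> fg df; apply: approx_diff; first exact: diff_continuous.
move=> e e0; have [d d0 H] := diff_approx df e0.
have /nbhs_ballP[r /= r0 B] := fg.
have [m m0 [md mr]] := exists_common_bound d0 r0.
exists m => // h hm.
have hd : `|h| < d by exact: lt_le_trans md.
have hr : `|h| < r by exact: lt_le_trans mr.
rewrite -(B x (ballxx x r0)) -(B (x + h)) ?H //.
by rewrite -ball_normE /= opprD addNKr normrN.
Qed.

End LinearAlgebra.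

Section LocalCalculus.
Variable R : realType.
Local Notation C := (cplx R).

Section Balls.
Variable V : normedModType C.

Lemma ball_segment (c x y : V) (r : C) (t : R) : 0 <= t <= 1 ->
  ball c r x -> ball c r y -> ball c r (line x (y - x) t).
Proof.
rewrite /line => /andP[t0 t1]; rewrite -ball_normE /= => cx cy.
have -> : c - (x + realC t *: (y - x))
    = realC (1 - t) *: (c - x) + realC t *: (c - y).
  have -> : realC (1 - t) = 1 - realC t :> C.
    exact: (rmorphB (real_complex R) 1 t).
  rewrite scalerBl scale1r opprD addrA -[RHS]addrA; congr (_ + _).
  rewrite addrC -scalerBr -scalerN; congr (_ *: _).
  by rewrite !opprB [RHS]addrC addrA subrK.
apply: (le_lt_trans (ler_normD _ _)); rewrite !normrZ !norm_realC.
rewrite !ger0_norm ?subr_ge0 //.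
have rE : r = realC (1 - t) * r + realC t * r.
  by rewrite -mulrDl -realCD subrK mul1r.
rewrite [ltRHS]rE.
have [->|tn0] := eqVneq t 0.
  by rewrite subr0 !mul0r !addr0 !mul1r.
apply: ler_ltD; last by rewrite ltr_pM2l // realC_gt0 lt_def tn0.
by rewrite ler_wpM2l ?realC_ge0 ?subr_ge0 // ltW.
Qed.

Lemma continuous_line (x v : V) : continuous (line x v : R -> V).
Proof.
rewrite /line.
move=> t; apply: cvgD; first exact: cvg_cst.
apply: (@cvg_comp _ _ _ (@realC R : R -> C) (fun z => z *: v) _ (nbhs (realC t : C))); last first.
  exact: scalel_continuous.
apply/cvgrPdist_lt => /= e e0; have [eE Re0] := pos_realC e0.
near=> s; rewrite eE.
have -> : realC t - realC s = realC (t - s) :> C.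
  by symmetry; exact: (rmorphB (real_complex R)).
rewrite norm_realC lt_realC.
by near: s; apply: cvgr_dist_lt.
Unshelve. all: by end_near. Qed.

Lemma connected_ball (c : V) (r : C) : connected (ball c r).
Proof.
have [r0|nr] := pselect (0 < r); last first.
  have -> : ball c r = set0.
    rewrite -subset0 => x; rewrite -ball_normE /= => h; apply: nr.
    exact: le_lt_trans h.
  exact: connected0.
have -> : ball c r = \bigcup_(x in ball c r)
    ((line c (x - c) : R -> V) @` `[0, 1]).
  apply/seteqP; split=> [x cx|x [y cy [t /=]]].
    exists x => //=; exists 1; first by rewrite in_itv /= ler01 lexx.
    by rewrite line1 addrCA subrr addr0.
  rewrite in_itv /= => t01 <-; apply: ball_segment => //; exact: ballxx.
apply: bigcup_connected.
  exists c => x cx /=; exists 0; first by rewrite in_itv /= lexx ler01.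
  by rewrite line0.
move=> x _; apply: connected_continuous_connected; first exact: segment_connected.
apply: continuous_subspaceT; exact: continuous_line.
Qed.

Lemma constant_on_ball (f : V -> C) c r :
  (forall x, ball c r x -> differentiable f x /\ forall v, 'd f x v = 0) ->
  forall x, ball c r x -> f x = f c.
Proof.
move=> df x cx.
have cc : ball c r c.
  move: cx; rewrite -ball_normE /= subrr normr0; exact: le_lt_trans.
apply/eqP; rewrite -subr_eq0 -normr_le0 -{1}(addrNK c x) (addrC (x - c)).
rewrite -[leRHS](mulr0 2); apply: mean_value_line => t t01.
have [d1 d2] := df _ (ball_segment t01 cc cx).
by rewrite d2 normr0.
Qed.

(** A fibre of [f] in [U] is open, and so is its complement in [U], because [f] is constant
    on balls. *)
Lemma constant_on_connected (U : set V) (f : V -> C) : open U -> connected U ->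
  (forall x, U x -> differentiable f x /\ forall v, 'd f x v = 0) ->
  forall x y, U x -> U y -> f x = f y.
Proof.
move=> oU cU df x y Ux Uy.
have opn (P : C -> Prop) : open (U `&` f @^-1` P).
  rewrite openE => z [Uz Pz]; have /nbhs_ballP[r /= r0 rU] := open_nbhs_nbhs (conj oU Uz).
  apply/nbhs_ballP; exists r => // w zw; split; first exact: rU.
  by rewrite /= (@constant_on_ball f z r) // => u /rU; exact: df.
have E : U `&` f @^-1` [set f x] = U.
  apply: cU; first by exists x.
    by exists (U `&` f @^-1` [set f x]) => //; rewrite setIA setIid.
  exists (~` (U `&` f @^-1` (~` [set f x]))); first by rewrite closedC.
  apply/seteqP; split=> z [Uz h]; split=> //; first by move=> [_]; apply.
  by apply: contrapT => fz; apply: h.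
by move: Uy; rewrite -E => -[_ /= ->].
Qed.

End Balls.
End LocalCalculus.

(** * Symmetry of second derivatives *)

Section SecondDerivatives.
Variable R : realType.
Local Notation C := (cplx R).
Variable V : normedModType C.

(** The second difference is the increment over [0, 1] of
    [f (x + s v + t s w) - f (x + t s w)] as a function of [t]. Its derivative is [s] times a
    difference of two values of [df(w)] near [x], to which the first-order expansion of [df(w)]
    at [x] applies. *)
Lemma second_difference (f : V -> C) x v w r (e : C) : 0 < r ->
  (forall y, ball x r y -> differentiable f y) ->
  differentiable (fun y => 'd f y w) x -> 0 < e ->
  exists2 d : C, 0 < d & forall s : C, `|s| < d ->
    `|f (x + s *: v + s *: w) - f (x + s *: v) - (f (x + s *: w) - f x)
      - s ^+ 2 * 'd (fun y => 'd f y w) x v| <= e * `|s| ^+ 2.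
Proof.
move=> r0 df ddf e0; set h := fun y => 'd f y w; set D := 'd h x.
(* N bounds the length, per unit of s, of every point reached; the 1 makes it positive. *)
pose N : C := 1 + `|v| + `|w|.
have N0 : 0 < N by rewrite /N -addrA ltr_pwDl // addr_ge0.
pose e1 := e / (4 * N).
have e10 : 0 < e1 by rewrite divr_gt0 // mulr_gt0.
have [d1 d10 H1] := diff_approx ddf e10.
have [d d0 [dd1 ddr]] := exists_common_bound (divr_gt0 d10 N0) (divr_gt0 r0 N0).
exists d => // s sd.
have small (t : R) (u : V) : 0 <= t <= 1 -> `|u| <= `|s| * `|v| ->
    `|u + realC t *: (s *: w)| <= `|s| * N.
  move=> /andP[t0 t1] hu; apply: (le_trans (ler_normD _ _)).
  have ht : `|realC t *: (s *: w)| <= `|s| * `|w|.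
    rewrite !normrZ norm_realC (ger0_norm t0) -[leRHS]mul1r ler_wpM2r ?mulr_ge0 //.
    by rewrite (le_realC _ 1).
  apply: (le_trans (lerD hu ht)).
  by rewrite -mulrDr ler_wpM2l // /N -addrA lerDr.
have sN1 : `|s| * N < d1.
  by rewrite -ltr_pdivlMr // (lt_le_trans sd).
have sNr : `|s| * N < r by rewrite -ltr_pdivlMr // (lt_le_trans sd).
have inb u : `|u| <= `|s| * N -> ball x r (x + u).
  by move=> hu; rewrite -ball_normE /= opprD addNKr normrN (le_lt_trans hu).
pose k1 (t : R) := s *: v + realC t *: (s *: w).
pose k2 (t : R) := realC t *: (s *: w).
have k1N t : 0 <= t <= 1 -> `|k1 t| <= `|s| * N.
  by move=> t01; apply: small => //; rewrite normrZ.
have k2N t : 0 <= t <= 1 -> `|k2 t| <= `|s| * N.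
  move=> t01; rewrite -[k2 t]add0r; apply: small => //.
  by rewrite normr0 mulr_ge0.
pose g t := f (line (x + s *: v) (s *: w) t) - f (line x (s *: w) t)
            - realC t * (s ^+ 2 * D v).
pose dg t := 'd f (line (x + s *: v) (s *: w) t) (s *: w)
             - 'd f (line x (s *: w) t) (s *: w) - s ^+ 2 * D v.
have gd (t : R) : 0 <= t <= 1 -> path_derive g t (dg t).
  move=> t01; apply: path_deriveB; last exact: path_derive_linear.
  apply: path_deriveB; apply: path_derive_line; apply: df.
    by rewrite /line -addrA; apply/inb/k1N.
  exact/inb/k2N.
have dgE t : dg t = s * ((h (x + k1 t) - h x - D (k1 t))
                       - (h (x + k2 t) - h x - D (k2 t))).
  have DE : D (k1 t) = s * D v + D (k2 t) by rewrite /k1 linearD linearZ.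
  have xE : line (x + s *: v) (s *: w) t = x + k1 t by rewrite /line /k1 addrA.
  rewrite DE /dg xE [line x _ t]/(x + k2 t) !linearZ /= -/(h (x + k1 t)) -/(h (x + k2 t)).
  rewrite /GRing.scale /=.
  move: (h (x + k1 t)) (h (x + k2 t)) (h x) (D v) (D (k2 t)) => A1 A2 A0 d1' d2'.
  ring.
have dgM (t : R) : 0 <= t <= 1 -> `|dg t| <= e / 2 * `|s| ^+ 2.
  move=> t01; rewrite dgE normrM.
  have -> : e / 2 * `|s| ^+ 2 = `|s| * (e1 * (`|s| * N) + e1 * (`|s| * N)).
    rewrite /e1; field.
    by rewrite gt_eqF.
  rewrite ler_wpM2l //; apply: (le_trans (ler_normB _ _)); apply: lerD.
    apply: le_trans (H1 _ _) _; first exact: le_lt_trans (k1N t t01) sN1.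
    by rewrite ler_wpM2l ?(ltW e10) // k1N.
  apply: le_trans (H1 _ _) _; first exact: le_lt_trans (k2N t t01) sN1.
  by rewrite ler_wpM2l ?(ltW e10) // k2N.
have := mean_value gd dgM.
rewrite /g !line1 !line0 mul1r mul0r subr0.
have -> : 2 * (e / 2 * `|s| ^+ 2) = e * `|s| ^+ 2 by field.
have alg (A1 A2 A3 A4 A5 : C) :
  A1 - A2 - A5 - (A3 - A4) = A1 - A3 - (A2 - A4) - A5 by ring.
by rewrite alg.
Qed.

(** The second difference of [f] is symmetric in [v] and [w], and after division by the square
    of the step it tends to each of the two mixed second derivatives. *)
Lemma schwarz (f : V -> C) x v w r : 0 < r ->
  (forall y, ball x r y -> differentiable f y) ->
  (forall u, differentiable (fun y => 'd f y u) x) ->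
  'd (fun y => 'd f y w) x v = 'd (fun y => 'd f y v) x w.
Proof.
move=> r0 df ddf; set D1 := LHS; set D2 := RHS.
apply/eqP; rewrite -subr_eq0 -normr_le0.
apply/ler_addgt0Pl => e e0; rewrite addr0.
have e20 : 0 < e / 2 by rewrite divr_gt0.
have [d1 d10 H1] := @second_difference f x v w r _ r0 df (ddf w) e20.
have [d2 d20 H2] := @second_difference f x w v r _ r0 df (ddf v) e20.
have [d d0 [dd1 dd2]] := exists_common_bound d10 d20.
pose s := d / 2.
have s0 : 0 < s by rewrite divr_gt0.
have sE : `|s| = s by rewrite gtr0_norm.
have sd : `|s| < d by rewrite sE ltr_pdivrMr // ltr_pMr // ltr1n.
have {}H1 : `|f (x + s *: v + s *: w) - f (x + s *: v) - (f (x + s *: w) - f x)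
    - s ^+ 2 * D1| <= e / 2 * s ^+ 2.
  by have := H1 s (lt_le_trans sd dd1); rewrite sE.
have {}H2 : `|f (x + s *: v + s *: w) - f (x + s *: w) - (f (x + s *: v) - f x)
    - s ^+ 2 * D2| <= e / 2 * s ^+ 2.
  by have := H2 s (lt_le_trans sd dd2); rewrite sE (addrAC x (s *: w)).
have s20 : 0 < s ^+ 2 by rewrite exprn_gt0.
rewrite -(ler_pM2r s20).
have -> : `|D1 - D2| * s ^+ 2 = `|s ^+ 2 * D1 - s ^+ 2 * D2|.
  by rewrite -mulrBr normrM mulrC normrX sE.
rewrite (splitr e) mulrDl.
apply: le_trans (lerD H2 H1); apply: le_trans (ler_normB _ _).
have alg (A1 A2 A3 A4 A5 A6 : C) :
  A5 - A6 = A1 - A2 - (A3 - A4) - A6 - (A1 - A3 - (A2 - A4) - A5) by ring.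
by rewrite -alg.
Qed.

End SecondDerivatives.

(** * The Poincare lemma *)

Section Primitives.
Variable R : realType.
Local Notation C := (cplx R).
Local Notation ReC := (@complex.Re R : C -> R).
Local Notation ImC := (@complex.Im R : C -> R).
Local Notation mu := (@lebesgue_measure R).

(** The interval on which the integrand is continuous is larger than [0, 1] so that the
    primitive is differentiable at both endpoints. *)
Lemma real_primitive (f : R -> R) :
  (forall t : R, -1 <= t <= 2 -> {for t, continuous f}) ->
  exists F : R -> R, forall t : R, 0 <= t <= 1 -> is_derive t 1 F (f t).
Proof.
move=> fc; exists (fun x => (\int[mu]_(t in [set` `[(-1 : R), x]]) (f t))%R).
move=> t /andP[t0 t1].
have [||||dF FE] := @continuous_FTC1_closed R f (-1) t 2.
- by rewrite (le_lt_trans t1) // ltr1n.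
- apply: continuous_compact_integrable; first exact: segment_compact.
  apply: continuous_in_subspaceT => x; rewrite inE /= in_itv /= => /fc.
  exact.
- by rewrite (lt_le_trans _ t0) // ltrN10.
- by apply: fc; rewrite (le_trans _ t0) ?lerN10 //= (le_trans t1) // ler1n.
split; first exact: dF.
by rewrite -FE derive1E.
Qed.

Lemma continuous_Re (f : R -> C) t : {for t, continuous f} ->
  {for t, continuous (ReC \o f)}.
Proof.
move=> fc; apply/cvgrPdist_lt => e e0.
have e0' : 0 < realC e :> C by rewrite realC_gt0.
move/cvgrPdist_lt : fc => /(_ _ e0'); apply: filterS => s /=.
rewrite -ReB -lt_realC; apply: le_lt_trans; exact: normc_ge_Re.
Qed.

Lemma continuous_Im (f : R -> C) t : {for t, continuous f} ->
  {for t, continuous (ImC \o f)}.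
Proof.
move=> fc; apply/cvgrPdist_lt => e e0.
have e0' : 0 < realC e :> C by rewrite realC_gt0.
move/cvgrPdist_lt : fc => /(_ _ e0'); apply: filterS => s /=.
rewrite -ImB -lt_realC; apply: le_lt_trans.
by rewrite -normrN -ReiNIm (le_trans (normc_ge_Re _)) // normrM complexiE normCi mulr1.
Qed.

Lemma path_primitive (f : R -> C) :
  (forall t : R, -1 <= t <= 2 -> {for t, continuous f}) ->
  exists F : R -> C, forall t : R, 0 <= t <= 1 -> path_derive F t (f t).
Proof.
move=> fc.
have [Fr HFr] := @real_primitive (ReC \o f) (fun t h => continuous_Re (fc t h)).
have [Fi HFi] := @real_primitive (ImC \o f) (fun t h => continuous_Im (fc t h)).
by exists (fun t => Complex (Fr t) (Fi t)) => t t01; split; [exact: HFr|exact: HFi].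
Qed.

Lemma path_deriveZ (f : R -> C) (t : R) (c : C) : path_derive f t c ->
  path_derive (fun s => realC s * f s) t (f t + realC t * c).
Proof.
move=> [fr fi]; split.
  have -> : ReC \o (fun s => realC s * f s) = id * (ReC \o f).
    by apply/funext => s; rewrite /= ReZ.
  have -> : ReC (f t + realC t * c) = t *: ReC c + ReC (f t) *: 1.
    case: (f t) c {fr fi} => [? ?] [? ?]; rewrite /GRing.scale /=; ring.
  exact: is_deriveM.
have -> : ImC \o (fun s => realC s * f s) = id * (ImC \o f).
  by apply/funext => s; rewrite /= ImZ.
have -> : ImC (f t + realC t * c) = t *: ImC c + ImC (f t) *: 1.
  case: (f t) c {fr fi} => [? ?] [? ?]; rewrite /GRing.scale /=; ring.
exact: is_deriveM.
Qed.

End Primitives.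

Section Poincare.
Variable R : realType.
Local Notation C := (cplx R).
Variable n : nat.
Local Notation E := ('rV[C]_n).
Local Notation e_ := (fun i => delta_mx 0 i : E).

(** All bounds on differentials are obtained on basis vectors, where they concern finitely many
    functions, and extended by this formula with constants uniform in the vector. *)
Lemma diff_expand (f : E -> C) x v :
  'd f x v = \sum_(i < n) v 0 i * 'd f x (e_ i).
Proof. by rewrite (linear_rV_expand (f := 'd f x)) // => a u w; rewrite linearP. Qed.

Lemma diff_sub_le (f : E -> C) x y v M :
  (forall i, `|'d f x (e_ i) - 'd f y (e_ i)| <= M) ->
  `|'d f x v - 'd f y v| <= n%:R * M * `|v|.
Proof.
move=> H.
have -> : 'd f x v - 'd f y v
    = \sum_(i < n) v 0 i * ('d f x (e_ i) - 'd f y (e_ i)).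
  under eq_bigr do rewrite mulrBr.
  by rewrite sumrB; congr (_ - _); exact: diff_expand.
exact: norm_lincomb_le.
Qed.

Lemma diff_lincomb (I : finType) (V : normedModType C) (c : I -> C) (G : I -> V -> C) x :
  (forall i, differentiable (G i) x) ->
  differentiable (fun y => \sum_i c i * G i y) x /\
  'd (fun y => \sum_i c i * G i y) x = (fun v => \sum_i c i * 'd (G i) x v) :> (V -> C).
Proof.
move=> dG; have key (s : seq I) :
    is_diff x (fun y => \sum_(i <- s) c i * G i y)
              (fun v => \sum_(i <- s) c i * 'd (G i) x v).
  elim: s => [|i s IH].
    have -> : (fun y => \sum_(i <- [::]) c i * G i y) = cst 0.
      by apply/funext => y; rewrite big_nil.
    have -> : (fun y => \sum_(i <- [::]) c i * 'd (G i) x y) = 0.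
      by apply/funext => y; rewrite big_nil.
    exact: is_diff_cst.
  have -> : (fun y => \sum_(i <- i :: s) c i * G i y)
      = (c i *: G i) + (fun y => \sum_(i <- s) c i * G i y).
    by apply/funext => y; rewrite big_cons.
  have -> : (fun y => \sum_(i <- i :: s) c i * 'd (G i) x y)
      = (c i *: ('d (G i) x : V -> C)) + (fun y => \sum_(i <- s) c i * 'd (G i) x y).
    by apply/funext => y; rewrite big_cons.
  apply: is_diffD; apply: is_diffZ; exact/differentiableP.
by have [] := key (index_enum I).
Qed.

Lemma ball_in_near (y0 : E) (A : set E) : nbhs y0 A ->
  exists2 r : C, 0 < r & ball y0 r `<=` A.
Proof. by move/nbhs_ballP. Qed.

(** Finitely many estimates, each valid for pairs of points near [y0], hold simultaneously
    on the square of one neighbourhood. *)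
Lemma near_pair_forall (I : finType) (y0 : E) (P : I -> E -> E -> Prop) :
  (forall i, \forall x \near y0 & y \near y0, P i x y) ->
  exists2 A, nbhs y0 A & forall x y, A x -> A y -> forall i, P i x y.
Proof.
move=> H; have /choice[A HA] : forall i, exists A : set E,
    nbhs y0 A /\ forall x y, A x -> A y -> P i x y.
  move=> i; have [[A B] /= [nA nB] AB] := H i.
  exists (A `&` B); split; first exact: filterI.
  by move=> x y [Ax _] [_ By]; exact: (AB (x, y)).
exists [set x | forall i, A i x].
  exact: (filter_forall (nbhs_filter y0) (fun i => (HA i).1)).
by move=> x y Ax Ay i; have [_] := HA i; apply.
Qed.

(** The partial derivatives are continuous at [y0], hence bounded near it. *)
Lemma holomorphic_lipschitz (U : set E) (g : E -> C) y0 : open U -> U y0 ->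
  holomorphic_upto 1 U g ->
  exists K : C, 0 <= K /\ \forall P \near y0 & Q \near y0,
    `|g P - g Q| <= K * `|P - Q|.
Proof.
move=> oU Uy0 [dg ddg].
pose M := 1 + \sum_i `|'d g y0 (e_ i)|.
have M0 : 0 <= M by rewrite addr_ge0 // sumr_ge0.
have nearM : \forall z \near y0, U z /\ forall i, `|'d g z (e_ i)| <= M.
  near=> z; split; first by near: z; exact: open_nbhs_nbhs.
  near: z; apply: filter_forall => i.
  have [dgi _] := ddg (e_ i).
  have /differentiable_continuous/cvgrPdist_le/(_ _ ltr01) := dgi _ Uy0.
  apply: filterS => z; rewrite /diff0 => h.
  rewrite /M (bigD1 i) //= addrA -[leLHS]addr0 lerD ?sumr_ge0 //.
  rewrite -lerBlDr; apply: le_trans h; rewrite distrC.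
  by rewrite (le_trans (lerB_dist _ _)).
have [r r0 rB] := ball_in_near nearM.
exists (2 * (n%:R * M)); split; first by rewrite !mulr_ge0.
exists (ball y0 r, ball y0 r) => /=; first by split; exact: (nbhsx_ballx y0 r r0).
move=> [P Q] /= [bP bQ].
rewrite -{1}(addrNK Q P) (addrC (P - Q)) -mulrA; apply: mean_value_line => t t01.
have [Ut dM] := rB _ (ball_segment t01 bQ bP).
split; first exact: dg.
by rewrite diff_expand; exact: norm_lincomb_le.
Unshelve. all: by end_near. Qed.

(** The remainder is controlled by the variation of the partial derivatives, which are
    themselves locally Lipschitz; the constant is uniform in the base point. *)
Lemma holomorphic_taylor (U : set E) (g : E -> C) y0 : open U -> U y0 ->
  holomorphic_upto 2 U g ->
  exists K : C, 0 <= K /\ \forall P \near y0 & Q \near y0,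
    `|g Q - g P - 'd g P (Q - P)| <= K * `|Q - P| ^+ 2.
Proof.
move=> oU Uy0 [dg ddg].
have /choice[K HK] : forall i, exists K : C, 0 <= K /\ \forall P \near y0 & Q \near y0,
    `|'d g P (e_ i) - 'd g Q (e_ i)| <= K * `|P - Q|.
  by move=> i; exact: holomorphic_lipschitz (ddg (e_ i)).
pose M := \sum_i K i.
have KM i : 0 <= K i <= M.
  have [K0 _] := HK i; rewrite K0 /M (bigD1 i) //= lerDl sumr_ge0 // => j _.
  by have [] := HK j.
have M0 : 0 <= M by apply: sumr_ge0 => i _; have /andP[] := KM i.
have [A nA AB] : exists2 A, nbhs y0 A & forall P Q, A P -> A Q -> forall i,
    `|'d g P (e_ i) - 'd g Q (e_ i)| <= M * `|P - Q|.
  apply: near_pair_forall => i; have [_ [[A B] nAB AB]] := HK i.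
  exists (A, B) => // -[P Q] /AB /= /le_trans; apply.
  by rewrite ler_wpM2r //; have /andP[] := KM i.
have [r r0 rB] := ball_in_near (filterI nA (open_nbhs_nbhs (conj oU Uy0))).
exists (2 * (n%:R * M)); split; first by rewrite !mulr_ge0.
exists (ball y0 r, ball y0 r) => /=; first by split; exact: (nbhsx_ballx y0 r r0).
move=> [P Q] /= [bP bQ]; set k : E := Q - P.
have -> : Q = P + k by rewrite /k addrC addrNK.
rewrite -mulrA; apply: mean_value_taylor => t t01.
have [a Ut] := rB _ (ball_segment t01 bP bQ); have [b _] := rB _ bP.
split; first exact: dg.
rewrite expr2 mulrA -(mulrA n%:R); apply: diff_sub_le => i.
apply: (le_trans (AB _ _ a b i)).
by rewrite ler_wpM2l // norm_line_le.
Qed.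

(** The primitive is the integral of [al] along the segment from [y0] to [y]. Its derivative
    is computed without differentiating under the integral sign: let [phi_y] be a primitive of
    [al] along that segment, [P t] its point and [v = y - y0]. For a small increment [h], put
    [G t = phi_(y+h) t - phi_y t - t al_(P t)(h)]. Closedness exchanges the derivative of [al(h)]
    along [v] for that of [al(v)] along [h], so that [G'] is the Taylor remainder of [al(v)]
    plus an increment of [al(h)]; both are O(|h|^2) uniformly in [t], and [G 1 - G 0] is the
    error in the claimed derivative. *)
Lemma poincare (U : set E) (al : form1 R n) y0 : open U -> U y0 ->
  (forall y, linear (al y)) ->
  (forall v, holomorphic_upto 2 U (fun y => al y v)) ->
  (forall y, U y -> forall v w, diff1 al y v w = 0) ->
  exists r F, [/\ 0 < r, ball y0 r `<=` U & forall y : E, ball y0 r y ->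
    differentiable F y /\ forall v, 'd F y v = al y v].
Proof.
move=> oU Uy0 lal hal cal.
have /choice[K HK] : forall i, exists K : C, 0 <= K /\ \forall P \near y0 & Q \near y0,
    `|al P (e_ i) - al Q (e_ i)| <= K * `|P - Q|.
  move=> i; apply: (holomorphic_lipschitz oU Uy0 (g := fun y => al y (e_ i))).
  have [da dda] := hal (e_ i); split=> // v.
  by have [] := dda v.
have /choice[T HT] : forall i, exists T : C, 0 <= T /\ \forall P \near y0 & Q \near y0,
    `|al Q (e_ i) - al P (e_ i) - 'd (fun y => al y (e_ i)) P (Q - P)|
      <= T * `|Q - P| ^+ 2.
  by move=> i; exact: (holomorphic_taylor oU Uy0 (hal (e_ i))).
pose M := \sum_i (K i + T i).
have K0 i : 0 <= K i by have [] := HK i.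
have T0 i : 0 <= T i by have [] := HT i.
have M0 : 0 <= M by apply: sumr_ge0 => i _; rewrite addr_ge0.
have KM i : K i <= M.
  by rewrite /M (bigD1 i) //= -addrA lerDl addr_ge0 // sumr_ge0 // => j _; rewrite addr_ge0.
have TM i : T i <= M.
  by rewrite /M (bigD1 i) //= addrAC lerDr addr_ge0 // sumr_ge0 // => j _; rewrite addr_ge0.
have [A nA AB] : exists2 A, nbhs y0 A & forall P Q, A P -> A Q -> forall i,
    `|al P (e_ i) - al Q (e_ i)| <= M * `|P - Q|.
  apply: near_pair_forall => i; have [_ [[A B] nAB AB]] := HK i.
  by exists (A, B) => // -[P Q] /AB /= /le_trans; apply; rewrite ler_wpM2r.
have [A' nA' AB'] : exists2 A, nbhs y0 A & forall P Q, A P -> A Q -> forall i,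
    `|al Q (e_ i) - al P (e_ i) - 'd (fun y => al y (e_ i)) P (Q - P)|
      <= M * `|Q - P| ^+ 2.
  apply: near_pair_forall => i; have [_ [[A' B'] nAB AB']] := HT i.
  by exists (A', B') => // -[P Q] /AB' /= /le_trans; apply; rewrite ler_wpM2r ?exprn_ge0.
have [r r0 rB] := ball_in_near (filterI (filterI nA nA')
  (open_nbhs_nbhs (conj oU Uy0))).
pose N := n%:R * M.
have N0 : 0 <= N by rewrite mulr_ge0.
have lip (P Q v : E) : ball y0 r P -> ball y0 r Q ->
    `|al P v - al Q v| <= N * `|P - Q| * `|v|.
  move=> /rB[[a _] _] /rB[[b _] _].
  rewrite !(linear_rV_expand (lal _) v) -sumrB.
  under eq_bigr do rewrite -mulrBr.
  by rewrite /N -(mulrA n%:R); apply: norm_lincomb_le => i; exact: AB.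
have alE v : (fun y => al y v) = (fun y => \sum_i v 0 i * al y (e_ i)).
  by apply/funext => y; rewrite (linear_rV_expand (lal y) v).
have dal y v : U y -> differentiable (fun y => al y v) y.
  by move=> Uy; have [h _] := hal v; exact: h.
have dalE (y v w : E) : U y ->
    'd (fun y => al y v) y w = \sum_i v 0 i * 'd (fun y => al y (e_ i)) y w.
  move=> Uy; rewrite alE.
  have [_ dE] := @diff_lincomb _ _ (v 0) (fun i y => al y (e_ i)) y (fun i => dal y _ Uy).
  exact: (congr1 (fun h => h w) dE).
have tay (P Q v : E) : ball y0 r P -> ball y0 r Q ->
    `|al Q v - al P v - 'd (fun y => al y v) P (Q - P)| <= N * `|Q - P| ^+ 2 * `|v|.
  move=> /rB[[_ a] UP] /rB[[_ b] _].
  rewrite dalE // !(linear_rV_expand (lal _) v) -!sumrB.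
  under eq_bigr do rewrite -!mulrBr.
  by rewrite /N -(mulrA n%:R); apply: norm_lincomb_le => i; exact: AB'.
(* The ray from y0 to a point of ball y0 q stays in ball y0 r for |t| <= 2. *)
pose q := r / 4.
have q0 : 0 < q by rewrite divr_gt0.
have rq : r = q + q + q + q by rewrite /q; field.
have ray (y : E) (t : R) : ball y0 q y -> -1 <= t <= 2 -> ball y0 r (line y0 (y - y0) t).
  rewrite /line -!ball_normE /= opprD addNKr normrN normrZ norm_realC distrC => hy /andP[t1 t2].
  have ht : realC `|t| <= realC 2 :> C.
    by rewrite le_realC ler_norml t2 andbT (le_trans _ t1) // lerN2 ler1n.
  have -> : r = realC 2 * q + 2 * q.
    by rewrite [realC 2](rmorph_nat (real_complex R) 2 : _ = _ :> C) /q; field.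
  apply: (@le_lt_trans _ _ (realC 2 * `|y - y0|)); first by rewrite ler_wpM2r.
  apply: (@le_lt_trans _ _ (realC 2 * q)); last by rewrite ltrDl mulr_gt0.
  by rewrite ler_wpM2l ?realC_ge0 // ltW.
have bqr : ball y0 q `<=` ball y0 r.
  by apply: le_ball; rewrite rq -!addrA lerDl !addr_ge0 // ltW.
have /choice[phi Hphi] : forall y : E, exists phi : R -> C, ball y0 q y ->
    forall t : R, 0 <= t <= 1 ->
      path_derive phi t (al (line y0 (y - y0) t) (y - y0)).
  move=> y; have [by_|nb] := pselect (ball y0 q y); last by exists (fun=> 0).
  have [|phi H] := @path_primitive R (fun t => al (line y0 (y - y0) t) (y - y0)).
    move=> t /(ray _ _ by_)/rB[_ Ut].
    apply: (@continuous_comp _ _ _ (line y0 (y - y0))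
              (fun z => al z (y - y0))); first exact: continuous_line.
    exact/differentiable_continuous/dal.
  by exists phi => _.
exists q, (fun y => phi y 1 - phi y 0); split; [exact: q0| |move=> y yB].
  by move=> y /bqr/rB[].
pose linM := GRing.isLinear.Build _ _ _ _ _ (lal y).
pose L : {linear E -> C} := HB.pack (al y) linM.
have Lc : continuous L := linear_rV_continuous (lal y).
suff H (e : C) : 0 < e -> exists2 d : C, 0 < d & forall h : E, `|h| < d ->
    `|(phi (y + h) 1 - phi (y + h) 0) - (phi y 1 - phi y 0) - L h| <= e * `|h|.
  have [dF dE] := @approx_diff _ _ _ (fun y => phi y 1 - phi y 0) L y Lc H.
  by split=> // v; rewrite dE.
move=> e0.
have [s s0 sB] : exists2 s, 0 < s & ball y s `<=` ball y0 q.
  by apply: ball_in_near; apply: open_nbhs_nbhs; split=> //; exact: ball_open.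
have [v vE] : exists v : E, y - y0 = v by exists (y - y0).
(* The 1 only makes Q positive, so that e / Q makes sense as a radius. *)
pose Q := 2 * (N * (1 + `|v|)) + 1.
have Q0 : 0 < Q by rewrite ltr_wpDl // !mulr_ge0 // addr_ge0.
have [d d0 [ds dQ]] := exists_common_bound s0 (divr_gt0 e0 Q0).
exists d => // h hd.
have hB : ball y0 q (y + h).
  by apply: sB; rewrite -ball_normE /= opprD addNKr normrN (lt_le_trans hd).
pose P (t : R) : E := line y0 v t.
pose dG t := al (line (P t) h t) (v + h) - al (P t) v
  - (al (P t) h + realC t * 'd (fun z => al z h) (P t) v).
have vhE : y + h - y0 = v + h by rewrite addrAC vE.
have in02 (t : R) : 0 <= t <= 1 -> -1 <= t <= 2.
  by move=> /andP[t0 t1]; rewrite (le_trans _ t0) ?lerN10 //= (le_trans t1) // ler1n.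
have Hd (t : R) : 0 <= t <= 1 -> path_derive
    (fun t : R => phi (y + h) t - phi y t - realC t * al (P t) h) t (dG t).
  move=> t01; have UP : U (P t).
    by have := ray _ _ yB (in02 _ t01); rewrite vE => /rB[].
  apply: path_deriveB; first apply: path_deriveB.
  - by have := Hphi _ hB t t01; rewrite vhE lineD.
  - by have := Hphi _ yB t t01; rewrite vE.
  apply: path_deriveZ; apply: path_derive_line; exact: dal.
have dGM (t : R) : 0 <= t <= 1 -> `|dG t| <= N * (1 + `|v|) * `|h| ^+ 2.
  move=> t01; have PB : ball y0 r (P t) by have := ray _ _ yB (in02 _ t01); rewrite vE.
  have PhB : ball y0 r (line (P t) h t).
    by have := ray _ _ hB (in02 _ t01); rewrite vhE lineD.
  have [_ UP] := rB _ PB.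
  have th := norm_line_le (P t) h t01.
  have sym : 'd (fun z => al z h) (P t) v = 'd (fun z => al z v) (P t) h.
    by apply/eqP; rewrite -subr_eq0; apply/eqP; exact: (cal _ UP v h).
  have lD z a b : al z (a + b) = al z a + al z b.
    by have := lal z 1 a b; rewrite !scale1r.
  have dZ : 'd (fun z => al z v) (P t) (line (P t) h t - P t)
      = realC t * 'd (fun z => al z v) (P t) h.
    by rewrite lineB; exact: linearZ.
  have -> : dG t = (al (line (P t) h t) v - al (P t) v
        - 'd (fun z => al z v) (P t) (line (P t) h t - P t))
      + (al (line (P t) h t) h - al (P t) h).
    have alg (S A1 A2 A3 A4 D1 D2 D3 u : C) : D3 = u * D2 -> D1 = D2 ->
        S = A1 + A3 -> S - A2 - (A4 + u * D1) = (A1 - A2 - D3) + (A3 - A4).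
      by move=> -> -> ->; ring.
    exact: (alg _ _ _ _ _ _ _ _ _ dZ sym (lD (line (P t) h t) v h)).
  apply: (le_trans (ler_normD _ _)).
  have -> : N * (1 + `|v|) * `|h| ^+ 2 = N * `|h| ^+ 2 * `|v| + N * `|h| * `|h|.
    by ring.
  apply: lerD.
    apply: (le_trans (tay _ _ _ PB PhB)).
    rewrite ler_wpM2r // ler_wpM2l //.
    by rewrite ler_pXn2r // nnegrE.
  apply: (le_trans (lip _ _ _ PhB PB)).
  by rewrite ler_wpM2r // ler_wpM2l.
have := mean_value Hd dGM; rewrite mul1r mul0r subr0.
have -> : P 1 = y by rewrite /P line1 -vE addrCA subrr addr0.
have -> : phi (y + h) 1 - phi y 1 - al y h - (phi (y + h) 0 - phi y 0)
   = (phi (y + h) 1 - phi (y + h) 0) - (phi y 1 - phi y 0) - L h.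
  rewrite /L /=; move: (phi _ _) (phi _ _) (phi _ _) (phi _ _) (al _ _) => A1 A2 A3 A4 A5.
  ring.
move=> /le_trans; apply.
rewrite expr2 !mulrA ler_wpM2r //.
apply: (@le_trans _ _ (Q * `|h|)).
  by rewrite ler_wpM2r // /Q !mulrA lerDl.
rewrite mulrC -ler_pdivlMr //.
by rewrite (le_trans (ltW hd)).
Qed.

End Poincare.

(** * The complex exponential *)

Section Exponential.
Variable R : realType.
Local Notation C := (cplx R).

Lemma expCD (z w : C) : expC (z + w) = expC z * expC w.
Proof.
case: z w => [x y] [u v] /=; rewrite expRD cosD sinD.
by congr Complex; rewrite /=; ring.
Qed.

Lemma expC0 : expC (0 : C) = 1.
Proof. by rewrite /= expR0 cos0 sin0 mul1r mulr0. Qed.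

Lemma expC_neq0 (z : C) : expC z != 0.
Proof.
apply/eqP => z0; have := expCD z (- z); rewrite z0 mul0r subrr expC0 => /eqP.
by rewrite oner_eq0.
Qed.

(** Along a real ray the exponential splits into products of real exponentials and
    trigonometric functions. *)
Lemma path_derive_expC (h : C) t :
  path_derive (fun s : R => expC (realC s * h)) t (h * expC (realC t * h)).
Proof.
case: h => x y.
have dx := is_derive_mulr t x; have dy := is_derive_mulr t y.
have dexp := @is_derive1_comp R expR (fun s => s * x) t _ _ (is_derive_expR _) dx.
have dcos := @is_derive1_comp R cos (fun s => s * y) t _ _ (is_derive_cos _) dy.
have dsin := @is_derive1_comp R sin (fun s => s * y) t _ _ (is_derive_sin _) dy.
have E s : realC s * Complex x y = Complex (s * x) (s * y) :> C.
  by rewrite /realC /=; congr Complex; rewrite ?mul0r ?subr0 ?addr0.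
split.
  have -> : (@complex.Re R : C -> R) \o (fun s : R => expC (realC s * Complex x y : C))
    = (expR \o (fun s : R => s * x)) * (cos \o (fun s : R => s * y)).
    by apply/funext => s; rewrite /comp E.
  apply: is_derive_eq; rewrite E /= /GRing.scale /=; ring.
have -> : (@complex.Im R : C -> R) \o (fun s : R => expC (realC s * Complex x y : C))
  = (expR \o (fun s : R => s * x)) * (sin \o (fun s : R => s * y)).
  by apply/funext => s; rewrite /comp E.
apply: is_derive_eq; rewrite E /= /GRing.scale /=; ring.
Qed.

Lemma norm_expC_le (z : C) : `|z| <= 1 -> `|expC z| <= realC (2 * expR 1).
Proof.
move=> z1; have := Re_le_norm (M := 1) z1; case: z {z1} => x y /= x1.
apply: (le_trans (norm_le_ReIm _)); rewrite le_realC /= mulr_natl mulr2n.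
have ex : expR x <= expR 1 by rewrite ler_expR (le_trans (ler_norm _)).
have bound (c : R) : -1 <= c <= 1 -> `|expR x * c| <= expR 1.
  move=> c1; rewrite normrM (ger0_norm (expR_ge0 x)) -[leRHS]mulr1.
  by rewrite ler_pM ?expR_ge0 // ler_norml.
by rewrite lerD // bound // -ler_norml ?cos_max ?sin_max.
Qed.

(** Two applications of the mean value inequality along [t h], using that the exponential is
    its own derivative and is bounded on the unit disc. *)
Lemma expC_taylor (h : C) : `|h| <= 1 ->
  `|expC h - 1 - h| <= 4 * realC (2 * expR 1) * `|h| ^+ 2.
Proof.
move=> h1; set B : C := realC (2 * expR 1).
have lip (w : C) : `|w| <= 1 -> `|expC w - 1| <= 2 * (`|w| * B).
  move=> w1; have := mean_value (M := `|w| * B) (fun t _ => path_derive_expC w t).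
  rewrite mul1r mul0r expC0; apply => t /andP[t0 t1].
  rewrite normrM ler_wpM2l // norm_expC_le // normrM norm_realC (ger0_norm t0).
  by rewrite mulr_ile1 // ?realC_ge0 // (le_realC _ 1).
have Hd (t : R) : 0 <= t <= 1 -> path_derive (fun t : R => expC (realC t * h) - realC t * h) t
    (h * expC (realC t * h) - h).
  by move=> _; apply: path_deriveB; [exact: path_derive_expC|exact: path_derive_linear].
have := mean_value (M := 2 * B * `|h| ^+ 2) Hd.
rewrite mul1r mul0r expC0 subr0 addrAC.
have -> : 2 * (2 * B * `|h| ^+ 2) = 4 * B * `|h| ^+ 2 by ring.
apply => t /andP[t0 t1].
have th : `|realC t * h| <= `|h|.
  by rewrite normrM norm_realC (ger0_norm t0) -[leRHS]mul1r ler_wpM2r // (le_realC _ 1).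
rewrite -[X in _ - X]mulr1 -mulrBr normrM.
have -> : 2 * B * `|h| ^+ 2 = `|h| * (2 * (`|h| * B)) by ring.
rewrite ler_wpM2l //; apply: (le_trans (lip _ (le_trans th h1))).
by rewrite ler_wpM2l // ler_wpM2r // realC_ge0 mulr_ge0 ?expR_ge0.
Qed.

(** By the addition formula the increment at [z] is [expC z] times the increment at 0. *)
Lemma expC_diff (z : C) : is_diff z (@expC R : C -> C) (fun h => expC z * h).
Proof.
have lin : linear (fun h : C => expC z * h : C).
  by move=> a u v; rewrite mulrDr /GRing.scale /= mulrCA.
pose M := GRing.isLinear.Build _ _ _ _ _ lin.
pose L : {linear C -> C} := HB.pack (fun h : C => expC z * h : C) M.
have Lc : continuous L by move=> u; exact: mulrl_continuous.
suff H e : 0 < e -> exists2 d : C, 0 < d & forall h, `|h| < d ->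
    `|(expC (z + h) : C) - expC z - L h| <= e * `|h|.
  by have [df dE] := @approx_diff _ _ _ (@expC R : C -> C) L z Lc H; exact: DiffDef.
move=> e0.
set B : C := realC (2 * expR 1).
have B0 : 0 <= B by rewrite realC_ge0 mulr_ge0 ?expR_ge0.
pose Q := `|expC z : C| * (4 * B) + 1.
have Q0 : 0 < Q by rewrite ltr_wpDl // !mulr_ge0.
have [d d0 [d1 dQ]] := exists_common_bound (@ltr01 C) (divr_gt0 e0 Q0).
exists d => // h hd.
rewrite expCD /L /=.
have -> : expC z * expC h - expC z - expC z * h = expC z * (expC h - 1 - h) by ring.
rewrite normrM.
apply: (le_trans (ler_wpM2l _ (expC_taylor _))) => //.
  by rewrite (le_trans (ltW hd)).
rewrite expr2 !mulrA ler_wpM2r //.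
apply: (@le_trans _ _ (Q * `|h|)).
  by rewrite ler_wpM2r // /Q !mulrA lerDl.
by rewrite mulrC -ler_pdivlMr // (le_trans (ltW hd)).
Qed.

End Exponential.

(** * Holomorphic functions and their logarithmic derivatives *)

Section Holomorphy.
Variable R : realType.
Local Notation C := (cplx R).

Lemma holomorphic_diff n k (U : set 'rV[C]_n) f : holomorphic_upto k U f ->
  forall x, U x -> differentiable f x.
Proof. by case: k => [|k] []. Qed.

Lemma holomorphic_uptoW n k (U : set 'rV[C]_n) f :
  holomorphic_upto k.+1 U f -> holomorphic_upto k U f.
Proof.
elim: k f => [|k IH] f [df hf]; first by split.
by split=> // v; exact/IH/hf.
Qed.

Lemma holomorphic_sub n k (U V : set 'rV[C]_n) f : V `<=` U ->
  holomorphic_upto k U f -> holomorphic_upto k V f.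
Proof.
move=> VU; elim: k f => [|k IH] f [df hf]; first by split=> // x /VU /df.
by split=> [x /VU /df //|v]; exact/IH/hf.
Qed.

Lemma holomorphic_ext n k (U : set 'rV[C]_n) f g : open U ->
  (forall x, U x -> f x = g x) -> holomorphic_upto k U f -> holomorphic_upto k U g.
Proof.
move=> oU; elim: k f g => [|k IH] f g fg [df hf].
  split=> // x Ux; apply: (diff_near_eq _ (df x Ux)).1.
  by apply: filterS (open_nbhs_nbhs (conj oU Ux)) => y; exact: fg.
have near_fg x : U x -> \forall y \near x, f y = g y.
  by move=> Ux; apply: filterS (open_nbhs_nbhs (conj oU Ux)) => y; exact: fg.
split=> [x Ux|v]; first exact: (diff_near_eq (near_fg x Ux) (df x Ux)).1.
apply: IH (hf v) => x Ux.
exact: esym (congr1 (fun h => h v) (diff_near_eq (near_fg x Ux) (df x Ux)).2).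
Qed.

Lemma holomorphic_cst n k (U : set 'rV[C]_n) (c : C) :
  holomorphic_upto k U (fun=> c).
Proof.
elim: k c => [|k IH] c; first by split=> // x _; exact: differentiable_cst.
split=> [x _|v]; first exact: differentiable_cst.
have -> : (fun x => diff0 (fun=> c) x v) = (fun=> 0).
  by apply/funext => x; exact: (congr1 (fun h => h v) (diff_cst c x)).
exact: IH.
Qed.

Lemma holomorphic_linear n k (U : set 'rV[C]_n) (f : 'rV[C]_n -> C) :
  linear f -> holomorphic_upto k U f.
Proof.
move=> lf; have df x := linear_is_diff x lf.
case: k => [|k]; first by split=> // x _; exact: (df x).1.
split=> [x _|v]; first exact: (df x).1.
have -> : (fun x => diff0 f x v) = (fun=> f v).
  by apply/funext => x; exact: (congr1 (fun h => h v) (df x).2).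
exact: holomorphic_cst.
Qed.

Lemma holomorphicD n k (U : set 'rV[C]_n) f g : open U ->
  holomorphic_upto k U f -> holomorphic_upto k U g ->
  holomorphic_upto k U (fun x => f x + g x).
Proof.
move=> oU; elim: k f g => [|k IH] f g [df hf] [dg hg].
  split=> [x Ux|]; last exact: I.
  by apply: differentiableD; [exact: df|exact: dg].
split=> [x Ux|v]; first by apply: differentiableD; [exact: df|exact: dg].
apply: (holomorphic_ext oU _ (IH _ _ (hf v) (hg v))) => x Ux.
exact: esym (congr1 (fun h => h v) (diffD (df x Ux) (dg x Ux))).
Qed.

(** Each derivative of the product involves the factors themselves, one order lower. *)
Lemma holomorphicM n k (U : set 'rV[C]_n) f g : open U ->
  holomorphic_upto k U f -> holomorphic_upto k U g ->
  holomorphic_upto k U (fun x => f x * g x).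
Proof.
move=> oU; elim: k f g => [|k IH] f g hf0 hg0.
  have [df _] := hf0; have [dg _] := hg0.
  split=> [x Ux|]; last exact: I.
  by apply: differentiableM; [exact: df|exact: dg].
have [df hf] := hf0; have [dg hg] := hg0.
split=> [x Ux|v]; first by apply: differentiableM; [exact: df|exact: dg].
have hf1 := holomorphic_uptoW hf0; have hg1 := holomorphic_uptoW hg0.
apply: (holomorphic_ext oU _
  (holomorphicD oU (IH _ _ hf1 (hg v)) (IH _ _ hg1 (hf v)))) => x Ux.
exact: esym (congr1 (fun h => h v) (diffM (df x Ux) (dg x Ux))).
Qed.

Lemma holomorphicZ n k (U : set 'rV[C]_n) f (c : C) : open U ->
  holomorphic_upto k U f -> holomorphic_upto k U (fun x => c * f x).
Proof. by move=> oU; apply: holomorphicM => //; exact: holomorphic_cst. Qed.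

(** For linear [phi] the derivative of [f o phi] along [v] is [df(phi v) o phi], again a
    composite with [phi]; the inclusion of Y and the identification with the Painleve variables
    are both linear. *)
Lemma holomorphic_comp_linear m n k (U : set 'rV[C]_n) (f : 'rV[C]_n -> C)
  (phi : 'rV[C]_m -> 'rV[C]_n) : open U -> linear phi ->
  holomorphic_upto k U f -> holomorphic_upto k (phi @^-1` U) (f \o phi).
Proof.
move=> oU lphi; have dphi x := linear_is_diff x lphi.
have oV : open (phi @^-1` U).
  by move/continuousP : (linear_rV_continuous lphi); exact.
elim: k f => [|k IH] f [df hf].
  split=> // x Ux; apply: differentiable_comp; [exact: (dphi x).1|exact: df].
split=> [x Ux|v].
  by apply: differentiable_comp; [exact: (dphi x).1|exact: df].
apply: (holomorphic_ext oV _ (IH _ (hf (phi v)))) => x Ux.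
have -> : phi v = 'd phi x v := esym (congr1 (fun h => h v) (dphi x).2).
exact: esym (congr1 (fun h => h v) (diff_comp (dphi x).1 (df _ Ux))).
Qed.

(** A bootstrap: [df = f al] expresses the derivatives of order [k + 1] of [f] by derivatives
    of order at most [k] of [f] and [al]. *)
Lemma holomorphic_dlog n (U : set 'rV[C]_n) (al : form1 R n) (f : 'rV[C]_n -> C) :
  open U -> (forall v, holomorphic U (fun y => al y v)) ->
  (forall x, U x -> differentiable f x) ->
  (forall x, U x -> forall v, 'd f x v = f x * al x v) -> holomorphic U f.
Proof.
move=> oU hal df dfE; elim=> [|k IH]; split=> // v.
apply: (holomorphic_ext oU _ (holomorphicM oU IH (hal v k))) => x Ux.
by rewrite /diff0 dfE.
Qed.

End Holomorphy.

Section TauFunctions.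
Variable R : realType.
Local Notation C := (cplx R).
Variable n : nat.

(** The exponential of a local primitive of [al]. *)
Lemma exists_dlog_primitive (U : set 'rV[C]_n) (al : form1 R n) y0 :
  open U -> U y0 -> (forall y, linear (al y)) ->
  (forall v, holomorphic U (fun y => al y v)) ->
  (forall y, U y -> forall v w, diff1 al y v w = 0) ->
  exists V tau, [/\ V y0, connected V, open V & V `<=` U] /\
    [/\ holomorphic V tau, forall y, V y -> tau y != 0
      & forall y, V y -> forall v, dlog tau y v = al y v].
Proof.
move=> oU Uy0 lal hal cal.
have [r [F [r0 rU dF]]] := poincare oU Uy0 lal (fun v => hal v 2) cal.
have dtau y : ball y0 r y -> is_diff y (@expC R \o F : _ -> C)
    ((fun h => expC (F y) * h) \o 'd F y).
  move=> yB; apply: is_diff_comp; first exact/differentiableP/(dF y yB).1.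
  exact: expC_diff.
have tau0 y : (@expC R \o F) y != 0 :> C by exact: expC_neq0.
have dtauE y : ball y0 r y -> forall v,
    'd (@expC R \o F : _ -> C) y v = (@expC R \o F) y * al y v.
  by move=> yB v; have [_ ->] := dtau y yB; rewrite /= (dF y yB).2.
have oB : open (ball y0 r) by exact: ball_open.
exists (ball y0 r), (@expC R \o F); split; split=> //.
- exact: ballxx.
- exact: connected_ball.
- apply: (@holomorphic_dlog _ _ _ al) => //; last by move=> y /dtau[].
  by move=> v k; exact: holomorphic_sub (hal v k).
- by move=> y yB v; rewrite /dlog /diff0 dtauE // mulrAC mulfV // mul1r.
Qed.

(** The quotient of the two functions has zero differential. *)
Lemma dlog_unique (V : set 'rV[C]_n) (tau tau' : 'rV[C]_n -> C) :
  open V -> connected V ->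
  (forall y, V y -> differentiable tau y /\ tau y != 0) ->
  (forall y, V y -> differentiable tau' y /\ tau' y != 0) ->
  (forall y, V y -> forall v, dlog tau' y v = dlog tau y v) ->
  exists2 c : C, c != 0 & forall y, V y -> tau' y = c * tau y.
Proof.
move=> oV cV H H' E.
have [[y0 Vy0]|V0] := pselect (V !=set0); last first.
  by exists 1; rewrite ?oner_eq0 // => y Vy; case: V0; exists y.
pose g := tau' * (fun y => (tau y)^-1).
have dg y : V y -> differentiable g y /\ forall v, 'd g y v = 0.
  move=> Vy; have [d1 n1] := H y Vy; have [d2 n2] := H' y Vy.
  have d3 := differentiableV d1 n1.
  split; first exact: differentiableM.
  move=> v.
  have dgE : 'd g y v = tau' y * 'd (fun y => (tau y)^-1) y v + (tau y)^-1 * 'd tau' y v.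
    exact: (congr1 (fun h => h v) (diffM d2 d3)).
  have diE : 'd (fun y => (tau y)^-1) y v = - tau y ^- 2 * 'd tau y v.
    exact: (congr1 (fun h => h v) (diffV d1 n1)).
  have alg (a b a1 a2 b1 c : C) : a != 0 -> b != 0 -> b1 / b = a1 / a ->
      a2 = - a ^- 2 * a1 -> c = b * a2 + a^-1 * b1 -> c = 0.
    move=> a0 b0 /(canRL (divfK b0)) -> -> ->; field.
    by rewrite a0.
  exact: (alg _ _ _ _ _ _ n1 n2 (E y Vy v) diE dgE).
have gc := constant_on_connected oV cV dg.
have [_ n1] := H y0 Vy0; have [_ n2] := H' y0 Vy0.
exists (g y0); first by rewrite /g !fctE mulf_neq0 // invr_neq0.
move=> y Vy; rewrite (gc _ _ Vy0 Vy) /g !fctE.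
by have [_ n3] := H y Vy; rewrite divfK.
Qed.

End TauFunctions.

(** * Explicit differentials and exterior derivatives *)

Section Differentials.
Variable R : realType.
Local Notation C := (cplx R).
Variable n : nat.
Local Notation E := ('rV[C]_n).

(** The differential is recorded by its values, so that an explicit formula can be given for it
    without an accompanying proof of linearity. *)
Definition has_diff (f : E -> C) (x : E) (df : E -> C) : Prop :=
  differentiable f x /\ forall v, 'd f x v = df v.

Lemma has_diff_eq f x df df' :
  has_diff f x df -> (forall v, df v = df' v) -> has_diff f x df'.
Proof. by move=> [h1 h2] h; split=> // v; exact: etrans (h2 v) (h v). Qed.

Lemma has_diff_cst c x : has_diff (fun=> c) x (fun=> 0).
Proof.
split; first exact: differentiable_cst.
by move=> v; exact: (congr1 (fun h => h v) (diff_cst c x)).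
Qed.

Lemma has_diff_linear (f : E -> C) x : linear f -> has_diff f x f.
Proof.
move=> l; have [h1 h2] := linear_is_diff x l; split=> // v.
exact: (congr1 (fun h => h v) h2).
Qed.

Lemma has_diff_coord i x : has_diff (fun y : E => y 0 i) x (fun v => v 0 i).
Proof. by apply: has_diff_linear => a u v; rewrite !mxE. Qed.

Lemma has_diffD f g x df dg : has_diff f x df -> has_diff g x dg ->
  has_diff (fun y => f y + g y) x (fun v => df v + dg v).
Proof.
move=> [f1 f2] [g1 g2]; split; first exact: differentiableD.
move=> v; rewrite -f2 -g2.
exact: (congr1 (fun h => h v) (diffD f1 g1)).
Qed.

Lemma has_diffN f x df : has_diff f x df -> has_diff (fun y => - f y) x (fun v => - df v).
Proof.
move=> [f1 f2]; split; first exact: differentiableN.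
move=> v; rewrite -f2.
exact: (congr1 (fun h => h v) (diffN f1)).
Qed.

Lemma has_diffM f g x df dg : has_diff f x df -> has_diff g x dg ->
  has_diff (fun y => f y * g y) x (fun v => f x * dg v + g x * df v).
Proof.
move=> [f1 f2] [g1 g2]; split; first exact: differentiableM.
move=> v; rewrite -f2 -g2.
exact: (congr1 (fun h => h v) (diffM f1 g1)).
Qed.

Lemma has_diffX f k x df : has_diff f x df ->
  has_diff (fun y => f y ^+ k.+1) x (fun v => k.+1%:R * f x ^+ k * df v).
Proof.
move=> [f1 f2].
have -> : (fun y => f y ^+ k.+1) = f ^+ k.+1 by apply/funext => y; rewrite exprfctE.
split; first exact: differentiableX.
move=> v; rewrite -f2.
exact: (congr1 (fun h => h v) (diffX k f1)).
Qed.

Lemma has_diffV f x df : f x != 0 -> has_diff f x df ->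
  has_diff (fun y => (f y)^-1) x (fun v => - f x ^- 2 * df v).
Proof.
move=> fx [f1 f2]; split; first exact: differentiableV.
move=> v; rewrite -f2.
exact: (congr1 (fun h => h v) (diffV f1 fx)).
Qed.

Lemma diff0_has_diff f x df v : has_diff f x df -> diff0 f x v = df v.
Proof. by move=> [_]; exact. Qed.

Lemma diff1_has_diff (al : form1 R n) x v w dw dv :
  has_diff (fun y => al y w) x dw -> has_diff (fun y => al y v) x dv ->
  diff1 al x v w = dw v - dv w.
Proof. by move=> [_ dwE] [_ dvE]; exact: (congr2 (fun a b => a - b) (dwE v) (dvE w)). Qed.

Lemma diff0_coord (i : 'I_n) (x v : E) : diff0 (fun y : E => y 0 i) x v = v 0 i.
Proof. exact: (diff0_has_diff v (has_diff_coord i x)). Qed.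

End Differentials.

Lemma has_diff_comp_linear (R : realType) m n (f : 'rV[cplx R]_n -> cplx R)
  (phi : 'rV[cplx R]_m -> 'rV[cplx R]_n) x df : linear phi ->
  has_diff f (phi x) df -> has_diff (fun y => f (phi y)) x (fun v => df (phi v)).
Proof.
move=> lphi [f1 f2]; have [p1 p2] := linear_is_diff x lphi; split.
  exact: (differentiable_comp (f := phi) (g := f)).
move=> v; rewrite -f2.
have -> : phi v = 'd phi x v := esym (congr1 (fun h => h v) p2).
exact: (congr1 (fun h => h v) (diff_comp p1 f1)).
Qed.

Lemma differentiable_rV (R : realType) m n (phi : 'rV[cplx R]_m -> 'rV[cplx R]_n) x
    (dphi : 'I_n -> 'rV[cplx R]_m -> cplx R) :
  (forall i, has_diff (fun y => phi y 0 i) x (dphi i)) ->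
  differentiable phi x /\ forall v i, 'd phi x v 0 i = dphi i v.
Proof.
move=> H; have dp : differentiable phi x.
  have -> : phi = \sum_(i < n) (fun y => phi y 0 i *: (delta_mx 0 i : 'rV[cplx R]_n)).
    by apply/funext => y; rewrite fct_sumE -row_sum_delta.
  apply: differentiable_sum => i; apply: differentiableZl.
  by have [] := H i.
split=> // v i; have [h1 <-] := H i.
have [c1 c2] := has_diff_coord i (phi x).
rewrite -(c2 ('d phi x v)).
exact: esym (congr1 (fun h => h v) (diff_comp (g := fun z : 'rV_n => z 0 i : cplx R) dp c1)).
Qed.

Ltac has_diff_tac := repeat first
  [ exact: has_diff_cst | exact: has_diff_coord | apply: has_diffD | apply: has_diffN
  | apply: has_diffX | apply: has_diffM ].

Section Coordinates.
Variable R : realType.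
Local Notation C := (cplx R).

Lemma incY_linear : linear (@incY R).
Proof.
move=> a u v; apply/rowP => -[[|[|[|[|//]]]] lt_k]; rewrite !mxE /= /aY /qY /pY ?mxE //.
by rewrite mulr0 addr0.
Qed.

Lemma identL_linear : linear (@identL R).
Proof.
move=> a u v; apply/rowP => -[[|[|[|//]]] lt_k]; rewrite !mxE /= /aY /qY /pY ?mxE //; ring.
Qed.

Lemma aX_incY (y : 'rV[C]_3) : aX (incY y) = y 0 0. Proof. by rewrite /aX mxE. Qed.
Lemma qX_incY (y : 'rV[C]_3) : qX (incY y) = y 0 1. Proof. by rewrite /qX mxE. Qed.
Lemma pX_incY (y : 'rV[C]_3) : pX (incY y) = y 0 2. Proof. by rewrite /pX mxE. Qed.
Lemma rX_incY (y : 'rV[C]_3) : rX (incY y) = 0. Proof. by rewrite /rX mxE. Qed.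

Lemma tL_identL (y : 'rV[C]_3) : tL (identL y) = 2 * y 0 0. Proof. by rewrite /tL mxE. Qed.
Lemma qL_identL (y : 'rV[C]_3) : qL (identL y) = y 0 1. Proof. by rewrite /qL mxE. Qed.
Lemma pL_identL (y : 'rV[C]_3) : pL (identL y) = - (2 * y 0 2). Proof. by rewrite /pL mxE. Qed.

(** The differential of b = p^2 - q^3 - a q. *)
Definition dbX (x v : 'rV[C]_4) : C :=
  2 * pX x * pX v - 3 * qX x ^+ 2 * qX v - aX x * qX v - qX x * aX v.

Lemma has_diff_bX x : has_diff (@bX R) x (dbX x).
Proof.
apply: has_diff_eq; first by rewrite /bX /aX /qX /pX; has_diff_tac.
move=> v; rewrite /dbX /aX /qX /pX /=; ring.
Qed.

Lemma projM_diff x : differentiable (@projM R) x /\ forall v : 'rV[C]_4,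
  aM ('d (@projM R) x v) = aX v /\ bM ('d (@projM R) x v) = dbX x v.
Proof.
pose dp (i : 'I_2) (v : 'rV[C]_4) : C := if i == 0 then aX v else dbX x v.
have [|d1 d2] := @differentiable_rV R 4 2 (@projM R) x dp.
  case=> [[|[|//]] lt_k] /=.
    have -> : (fun y => projM y 0 (Ordinal lt_k)) = (fun y : 'rV[C]_4 => y 0 0).
      by apply/funext => y; rewrite mxE.
    exact: has_diff_coord.
  have -> : (fun y => projM y 0 (Ordinal lt_k)) = @bX R.
    by apply/funext => y; rewrite mxE.
  exact: has_diff_bX.
by split=> // v; split; [exact: (d2 v 0)|exact: (d2 v 1)].
Qed.

Lemma Omega0E (m v w : 'rV[C]_2) : Omega0 m v w = aM v * bM w - aM w * bM v.
Proof. by rewrite /Omega0 /wedge !(diff0_coord (n := 2)). Qed.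

Lemma pull_Omega0 (x v w : 'rV[C]_4) :
  pull2 (@projM R) (@Omega0 R) x v w = aX v * dbX x w - aX w * dbX x v.
Proof.
have [_ H] := projM_diff x; have [va vb] := H v; have [wa wb] := H w.
by rewrite /pull2 Omega0E va vb wa wb.
Qed.

Lemma OmegaIE (x v w : 'rV[C]_4) :
  2 * 'i * OmegaI x v w = qX v * pX w - qX w * pX v + (aX v * rX w - aX w * rX v).
Proof.
rewrite /OmegaI /wedge !(diff0_coord (n := 4)) mulrA mulfV ?mul1r //.
by rewrite mulf_neq0 ?neq0Ci // pnatr_eq0.
Qed.

(** The co-ordinate phi_2 = r / (2 p) vanishes identically on Y, so its differential vanishes
    on vectors tangent to Y. *)
Lemma OmegaInf_Y (y v w : 'rV[C]_3) : pY y != 0 ->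
  OmegaInf (incY y) (incY v) (incY w) = 0.
Proof.
move=> py; have p0 : pX (incY y) != 0 by rewrite pX_incY.
have phi2 u : diff0 (fun x : 'rV[C]_4 => rX x / (2 * pX x)) (incY y) (incY u) = 0.
  have p20 : 2 * pX (incY y) != 0 by rewrite mulf_neq0 // pnatr_eq0.
  have hp : has_diff (fun x : 'rV[C]_4 => 2 * pX x) (incY y) (fun v => 2 * pX v).
    by apply: has_diff_eq; [rewrite /pX; has_diff_tac|move=> z /=; rewrite /pX; ring].
  rewrite (diff0_has_diff _ (has_diffM (has_diff_coord 3 (incY y)) (has_diffV p20 hp))).
  have := rX_incY u; have := rX_incY y; rewrite /rX => -> ->.
  by rewrite mul0r mulr0 addr0.
by rewrite /OmegaInf /wedge !phi2 !mulr0 subrr.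
Qed.

Lemma diff1_Theta0 (m v w : 'rV[C]_2) : diff1 (@Theta0 R) m v w = Omega0 m v w.
Proof.
have E (u : 'rV[C]_2) : (fun y => Theta0 y u)
    = (fun y => 4 * y 0 0 / 5 * u 0 1 - u 0 0 * (6 * y 0 1 / 5) + y 0 1 * u 0 0).
  apply/funext => y.
  by rewrite /Theta0 /Defs.contract Omega0E (diff0_coord (n := 2)) /aM /bM !mxE.
have D u : has_diff (fun y => Theta0 y u) m
    (fun v => 4 * v 0 0 / 5 * u 0 1 - u 0 0 * (6 * v 0 1 / 5) + v 0 1 * u 0 0).
  rewrite E; apply: has_diff_eq; first by has_diff_tac.
  move=> z /=; ring.
by rewrite (diff1_has_diff (D w) (D v)) Omega0E /aM /bM; field.
Qed.

End Coordinates.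

Section HolomorphicForms.
Variable R : realType.
Local Notation C := (cplx R).

Lemma holomorphicN n k (U : set 'rV[C]_n) (f : 'rV[C]_n -> C) : open U ->
  holomorphic_upto k U f -> holomorphic_upto k U (fun x => - f x).
Proof.
move=> oU hf; apply: (holomorphic_ext oU _ (holomorphicZ (-1) oU hf)) => x _.
by rewrite mulN1r.
Qed.

Lemma holomorphicX n k (U : set 'rV[C]_n) (f : 'rV[C]_n -> C) j : open U ->
  holomorphic_upto k U f -> holomorphic_upto k U (fun x => f x ^+ j).
Proof.
move=> oU hf; elim: j => [|j IH].
  by apply: (holomorphic_ext oU _ (holomorphic_cst k U 1)) => x _; rewrite expr0.
by apply: (holomorphic_ext oU _ (holomorphicM oU hf IH)) => x _; rewrite exprS.
Qed.

Lemma holomorphic_coord n k (U : set 'rV[C]_n) i :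
  holomorphic_upto k U (fun x : 'rV[C]_n => x 0 i : C).
Proof. by apply: holomorphic_linear => a u v; rewrite !mxE. Qed.

(** The closedness of exact 1-forms. *)
Lemma second_diff_sym n (N : set 'rV[C]_n) (f : 'rV[C]_n -> C) x v w :
  open N -> holomorphic N f -> N x ->
  'd (fun y => diff0 f y w) x v = 'd (fun y => diff0 f y v) x w.
Proof.
move=> oN hf Nx.
have /nbhs_ballP[r /= r0 rN] := open_nbhs_nbhs (conj oN Nx).
have [df ddf] := hf 1.
apply: (schwarz _ _ r0) => [y /rN|u]; first exact: df.
by have [h _] := ddf u; exact: h.
Qed.

Lemma holomorphic_has_diff n (N : set 'rV[C]_n) (f : 'rV[C]_n -> C) x :
  holomorphic N f -> N x -> has_diff f x (diff0 f x).
Proof. by move=> hf Nx; split=> //; exact: holomorphic_diff (hf 0) _ Nx. Qed.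

Lemma holomorphic_diff0 n (N : set 'rV[C]_n) (f : 'rV[C]_n -> C) u :
  holomorphic N f -> holomorphic N (fun x => diff0 f x u).
Proof. by move=> hf k; have [_] := hf k.+1; exact. Qed.

(** The term f d(dg) vanishes. *)
Lemma diff1_mul_diff0 n (N : set 'rV[C]_n) (f g : 'rV[C]_n -> C) (c : C) x v w :
  open N -> holomorphic N f -> holomorphic N g -> N x ->
  diff1 (fun y v => c * (f y * diff0 g y v)) x v w = c * wedge (diff0 f) (diff0 g) x v w.
Proof.
move=> oN hf hg Nx.
have D u : has_diff (fun y => c * (f y * diff0 g y u)) x
    (fun z => c * (f x * diff0 (fun y => diff0 g y u) x z + diff0 g x u * diff0 f x z)).
  apply: has_diff_eq.
    apply: has_diffM; first exact: has_diff_cst.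
    apply: has_diffM; first exact: holomorphic_has_diff hf Nx.
    exact: holomorphic_has_diff (holomorphic_diff0 u hg) Nx.
  by move=> z /=; rewrite mulr0 addr0.
rewrite (diff1_has_diff (D w) (D v)).
have S : diff0 (fun y => diff0 g y w) x v = diff0 (fun y => diff0 g y v) x w.
  exact: second_diff_sym oN hg Nx.
have alg (A B F p q r s : C) : A = B ->
    c * (F * A + q * p) - c * (F * B + s * r) = c * (p * q - r * s).
  by move=> ->; ring.
exact: (alg _ _ _ _ _ _ _ S).
Qed.

End HolomorphicForms.

Ltac holomorphic_tac oU := repeat first
  [ exact: holomorphic_cst | exact: holomorphic_coord | apply: (holomorphicD oU)
  | apply: (holomorphicN oU) | apply: (holomorphicX _ oU) | apply: (holomorphicM oU) ].

(** * The tau-form on Y *)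

Section JoyceForms.
Variable R : realType.
Local Notation C := (cplx R).

Lemma twopii_neq0 : twopii R != 0.
Proof.
rewrite /twopii !mulf_neq0 ?pnatr_eq0 ?neq0Ci //.
by rewrite gt_eqF // realC_gt0 pi_gt0.
Qed.

Definition dbY (y v : 'rV[C]_3) : C :=
  2 * y 0 2 * v 0 2 - 3 * y 0 1 ^+ 2 * v 0 1 - y 0 0 * v 0 1 - y 0 1 * v 0 0.

Lemma dbX_incY (y v : 'rV[C]_3) : dbX (incY y) (incY v) = dbY y v.
Proof. by rewrite /dbX !aX_incY !qX_incY !pX_incY. Qed.

Lemma bYE (y : 'rV[C]_3) : bY y = y 0 2 ^+ 2 - y 0 1 ^+ 3 - y 0 0 * y 0 1.
Proof. by rewrite /bY /bX aX_incY qX_incY pX_incY. Qed.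

Lemma has_diff_bY (y : 'rV[C]_3) : has_diff (@bY R) y (dbY y).
Proof.
have -> : @bY R = fun y => y 0 2 ^+ 2 - y 0 1 ^+ 3 - y 0 0 * y 0 1.
  by apply/funext => z; rewrite bYE.
apply: has_diff_eq; first by has_diff_tac.
move=> v; rewrite /dbY /=; ring.
Qed.

Lemma aM_eulerM (m : 'rV[C]_2) : aM (eulerM m) = 4 * aM m / 5.
Proof. by rewrite {1}/aM mxE. Qed.

Lemma bM_eulerM (m : 'rV[C]_2) : bM (eulerM m) = 6 * bM m / 5.
Proof. by rewrite {1}/bM mxE. Qed.

Lemma aM_projM (x : 'rV[C]_4) : aM (projM x) = aX x.
Proof. by rewrite /aM mxE. Qed.

Lemma bM_projM (x : 'rV[C]_4) : bM (projM x) = bX x.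
Proof. by rewrite /bM mxE. Qed.

Lemma diff0_aM (m v : 'rV[C]_2) : diff0 (@aM R) m v = aM v.
Proof. exact: (diff0_coord (n := 2)). Qed.

Lemma qX_eulerX (x : 'rV[C]_4) : qX (eulerX x) = 2 * qX x / 5.
Proof. by rewrite {1}/qX mxE. Qed.

Lemma rX_eulerX (x : 'rV[C]_4) : rX (eulerX x) = rX x / 5.
Proof. by rewrite {1}/rX mxE. Qed.

(** The equation p^2 = q^3 + a q + b is homogeneous of weight 6/5, so p has weight 3/5. *)
Lemma pX_eulerX_incY (y : 'rV[C]_3) : pY y != 0 ->
  pX (eulerX (incY y)) = 3 * y 0 2 / 5.
Proof.
rewrite /pY => py.
rewrite {1}/pX mxE /= aX_incY qX_incY pX_incY -/(bY y) bYE; field.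
by rewrite py.
Qed.

(** The tau-form restricted to Y in the co-ordinates (a, q, p). *)
Definition formY (eps : C) (x1 x2 : 'rV[C]_4 -> C) : form1 R 3 := fun y v =>
  eps ^- 2 * (- (6 * bY y / 5) * v 0 0 + 4 * y 0 0 / 5 * dbY y v + bY y * v 0 0)
  + eps^-1 * (2 * y 0 1 / 5 * v 0 2 - 3 * y 0 2 / 5 * v 0 1)
  + (twopii R)^-1 * (x1 (incY y) * diff0 x2 (incY y) (incY v)).

Lemma tau_formE (eps : C) (x1 x2 : 'rV[C]_4 -> C) (y v : 'rV[C]_3) : pY y != 0 ->
  pull1 (@incY R) (tau_form eps (@Theta0 R) (@ThetaI R) (Theta1 x1 x2)) y v
  = formY eps x1 x2 y v.
Proof.
move=> py; rewrite /pull1.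
have -> : 'd (@incY R) y v = incY v.
  exact: (congr1 (fun h => h v) (linear_is_diff y (@incY_linear R)).2).
rewrite /tau_form /formY; have [_ H] := projM_diff (incY y).
have [Ha Hb] := H (incY v).
have T0 : pull1 (@projM R) (@Theta0 R) (incY y) (incY v)
    = - (6 * bY y / 5) * v 0 0 + 4 * y 0 0 / 5 * dbY y v + bY y * v 0 0.
  rewrite /pull1 /Theta0 /Defs.contract Omega0E Ha Hb.
  rewrite diff0_aM Ha dbX_incY aM_eulerM bM_eulerM aM_projM bM_projM aX_incY.
  by rewrite -/(bY y) aX_incY; ring.
have T1 : 2 * 'i * eps^-1 * ThetaI (incY y) (incY v)
    = eps^-1 * (2 * y 0 1 / 5 * v 0 2 - 3 * y 0 2 / 5 * v 0 1).
  rewrite mulrAC mulrC; congr (_ * _).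
  rewrite /ThetaI /Defs.contract OmegaIE rX_incY (qX_incY v) (pX_incY v).
  rewrite qX_eulerX pX_eulerX_incY // rX_eulerX rX_incY qX_incY; ring.
rewrite T0 T1 /Theta1; ring.
Qed.

Lemma formY_linear (eps : C) (x1 x2 : 'rV[C]_4 -> C) y : linear (formY eps x1 x2 y).
Proof.
move=> a u v; rewrite /formY.
have l : diff0 x2 (incY y) (incY (a *: u + v))
    = a * diff0 x2 (incY y) (incY u) + diff0 x2 (incY y) (incY v).
  by rewrite incY_linear; exact: linearP.
rewrite l /dbY !mxE /GRing.scale /=; ring.
Qed.

End JoyceForms.

(** * The Joyce structure tau-function *)

Section JoyceTau.
Variable R : realType.
Local Notation C := (cplx R).
Variables (eps : C) (N : set 'rV[C]_4) (x1 x2 : 'rV[C]_4 -> C).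
Hypothesis fg : fg_coordinates eps N x1 x2.
Local Notation NY := (@incY R @^-1` N).

Let oN : open N. Proof. by have [] := fg. Qed.
Let hx1 : holomorphic N x1. Proof. by have [] := fg. Qed.
Let hx2 : holomorphic N x2. Proof. by have [] := fg. Qed.

Let pY_neq0 y : NY y -> pY y != 0.
Proof.
have [_ NX _ _ _] := fg => /NX[_]; by rewrite pX_incY.
Qed.

Let oNY : open NY.
Proof. by have /continuousP := linear_rV_continuous (@incY_linear R); exact. Qed.

(** Restricted to Y the symplectic identity of [fg_coordinates] has no Omega_infinity term. It
    says that d(x1 dx2) / (2 pi i) cancels eps^-2 Omega_0 + 2 i eps^-1 Omega_I, which is the
    exterior derivative of the polynomial part of the form. *)
Lemma formY_closed y v w : NY y -> diff1 (formY eps x1 x2) y v w = 0.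
Proof.
move=> Ny.
(* dd v w and D2 v w are the derivatives along v of db(w) and of dx2(w). *)
pose dd (v w : 'rV[C]_3) : C := 2 * v 0 2 * w 0 2 - 6 * y 0 1 * v 0 1 * w 0 1
   - v 0 0 * w 0 1 - v 0 1 * w 0 0.
pose D2 (v w : 'rV[C]_3) := diff0 (fun x => diff0 x2 x (incY w)) (incY y) (incY v).
have Hx1 : has_diff (fun y => x1 (incY y)) y (fun v => diff0 x1 (incY y) (incY v)).
  apply: has_diff_comp_linear; first exact: incY_linear.
  exact: holomorphic_has_diff hx1 Ny.
have Hx2 u : has_diff (fun y => diff0 x2 (incY y) (incY u)) y (D2 ^~ u).
  apply: (has_diff_comp_linear (f := fun x => diff0 x2 x (incY u))); first exact: incY_linear.
  exact: holomorphic_has_diff (holomorphic_diff0 _ hx2) Ny.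
have Hd u : has_diff (fun y => dbY y u) y (dd ^~ u).
  apply: has_diff_eq; first by rewrite /dbY; has_diff_tac.
  move=> z; rewrite /dd /=; ring.
have Dp (u : 'rV[C]_3) : has_diff (fun y => eps ^- 2 * (- (6 * bY y / 5) * u 0 0
        + 4 * y 0 0 / 5 * dbY y u + bY y * u 0 0)
      + eps^-1 * (2 * y 0 1 / 5 * u 0 2 - 3 * y 0 2 / 5 * u 0 1)) y (fun z =>
    eps ^- 2 * (- (6 * dbY y z / 5) * u 0 0
        + (4 * z 0 0 / 5 * dbY y u + 4 * y 0 0 / 5 * dd z u) + dbY y z * u 0 0)
      + eps^-1 * (2 * z 0 1 / 5 * u 0 2 - 3 * z 0 2 / 5 * u 0 1)).
  apply: has_diff_eq.
    by repeat first [exact: has_diff_bY | exact: Hd | exact: has_diff_cst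
     | exact: has_diff_coord | apply: has_diffD | apply: has_diffN | apply: has_diffM].
  move=> z /=; move: (dbY y z) (dbY y u) (dd z u) (bY y) => d1 d2 d3 b; ring.
have Dx (u : 'rV[C]_3) : has_diff
    (fun y => (twopii R)^-1 * (x1 (incY y) * diff0 x2 (incY y) (incY u))) y
    (fun z => (twopii R)^-1 * (x1 (incY y) * D2 z u
        + diff0 x2 (incY y) (incY u) * diff0 x1 (incY y) (incY z))).
  apply: has_diff_eq.
    exact: has_diffM (has_diff_cst _ _) (has_diffM Hx1 (Hx2 u)).
  by move=> z /=; rewrite mulr0 addr0.
have D u : has_diff (fun y => formY eps x1 x2 y u) y _ := has_diffD (Dp u) (Dx u).
have S : D2 v w = D2 w v by exact: second_diff_sym oN hx2 Ny.
have [_ _ _ _ [_ /(_ _ Ny (incY v) (incY w))]] := fg.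
have T : 2 * 'i * eps^-1 * OmegaI (incY y) (incY v) (incY w)
    = eps^-1 * (v 0 1 * w 0 2 - w 0 1 * v 0 2).
  rewrite mulrAC mulrC; congr (_ * _).
  by rewrite OmegaIE !rX_incY !qX_incY !pX_incY !mulr0 subrr addr0.
rewrite T pull_Omega0 OmegaInf_Y ?pY_neq0 // !dbX_incY !aX_incY addr0.
have Sd : dd v w = dd w v by rewrite /dd; ring.
(* The closedness identity with the differentials replaced by free scalars. *)
have alg (A A' B B' F p q r s bv bw f ei tp : C) : A = A' -> B = B' ->
    - tp * (p * q - r * s) = ei ^+ 2 * (v 0 0 * bw - w 0 0 * bv)
        + ei * (v 0 1 * w 0 2 - w 0 1 * v 0 2) ->
    ei ^+ 2 * (- (6 * bv / 5) * w 0 0 + (4 * v 0 0 / 5 * bw + 4 * f / 5 * B) + bv * w 0 0)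
      + ei * (2 * v 0 1 / 5 * w 0 2 - 3 * v 0 2 / 5 * w 0 1) + tp * (F * A + q * p)
    - (ei ^+ 2 * (- (6 * bw / 5) * v 0 0 + (4 * w 0 0 / 5 * bv + 4 * f / 5 * B') + bw * v 0 0)
      + ei * (2 * w 0 1 / 5 * v 0 2 - 3 * w 0 2 / 5 * v 0 1) + tp * (F * A' + s * r)) = 0.
  move=> -> -> H.
  have E : tp * (q * p) - tp * (s * r)
      = - (ei ^+ 2 * (v 0 0 * bw - w 0 0 * bv) + ei * (v 0 1 * w 0 2 - w 0 1 * v 0 2)).
    by rewrite -H; ring.
  by rewrite -[RHS](subrr (tp * (q * p) - tp * (s * r))) {2}E; field.
rewrite (diff1_has_diff (D w) (D v)) -!exprVn.
by apply: alg S Sd.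
Qed.



Lemma formY_holomorphic v : holomorphic NY (fun y => formY eps x1 x2 y v).
Proof.
move=> k.
have hb : holomorphic_upto k NY (@bY R).
  have -> : @bY R = fun y => y 0 2 ^+ 2 - y 0 1 ^+ 3 - y 0 0 * y 0 1.
    by apply/funext => z; rewrite bYE.
  by holomorphic_tac oNY.
have hdb : holomorphic_upto k NY (fun y => dbY y v).
  by rewrite /dbY; holomorphic_tac oNY.
have h1 : holomorphic_upto k NY (fun y => x1 (incY y)).
  exact: (holomorphic_comp_linear oN (@incY_linear R) (hx1 k)).
have h2 : holomorphic_upto k NY (fun y => diff0 x2 (incY y) (incY v)).
  exact: (holomorphic_comp_linear oN (@incY_linear R) (holomorphic_diff0 _ hx2 k)).
rewrite /formY; apply: (holomorphicD oNY); last first.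
  by apply: (holomorphicZ _ oNY); apply: (holomorphicM oNY).
by repeat first
  [ exact: hb | exact: hdb | exact: holomorphic_cst | exact: holomorphic_coord
  | apply: (holomorphicD oNY) | apply: (holomorphicN oNY) | apply: (holomorphicM oNY) ].
Qed.

Local Notation isTau := (is_tauY eps N (@Theta0 R) (@ThetaI R) (Theta1 x1 x2)).

Lemma is_tauY_dlog V tau y v : isTau V tau -> V y ->
  dlog tau y v = formY eps x1 x2 y v.
Proof.
move=> [oV VN htau tau0 dtau] Vy.
by rewrite (dtau y Vy v) tau_formE // pY_neq0 //; exact: VN.
Qed.

Lemma tauY_defined : defined_up_to_constant NY isTau.
Proof.
split=> [y Ny|V tau tau' cV H H'].
  have [V [tau [[Vy cV oV VN] [htau tau0 dtau]]]] := exists_dlog_primitive oNY Ny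
    (formY_linear eps x1 x2) formY_holomorphic (fun y Ny v w => formY_closed v w Ny).
  exists V, tau; split=> //; split=> // z Vz v.
  by rewrite (dtau z Vz v) tau_formE // pY_neq0 //; exact: VN.
have [oV _ htau tau0 _] := H; have [_ _ htau' tau0' _] := H'.
apply: dlog_unique => //.
- by move=> y Vy; split; [exact: holomorphic_diff (htau 0) _ Vy|exact: tau0].
- by move=> y Vy; split; [exact: holomorphic_diff (htau' 0) _ Vy|exact: tau0'].
- by move=> y Vy v; rewrite (is_tauY_dlog v H Vy) (is_tauY_dlog v H' Vy).
Qed.

Lemma diff0_x2_incY (f : 'rV[C]_4 -> C) y v : holomorphic N f -> NY y ->
  diff0 (f \o @incY R) y v = diff0 f (incY y) (incY v).
Proof.
move=> hf Ny.
exact: (diff0_has_diff v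
  (has_diff_comp_linear (@incY_linear R) (holomorphic_has_diff hf Ny))).
Qed.

Lemma is_tauY_formula V tau y v : isTau V tau -> V y ->
  dlog tau y v
  = eps ^- 2 * (- (6 * bY y / 5) * diff0 (@aY R) y v
                + 4 * aY y / 5 * diff0 (@bY R) y v
                + bY y * diff0 (@aY R) y v)
    + eps^-1 * (2 * qY y / 5 * diff0 (@pY R) y v
                - 3 * pY y / 5 * diff0 (@qY R) y v)
    + (twopii R)^-1 * (x1 (incY y) * diff0 (x2 \o @incY R) y v).
Proof.
move=> H Vy; rewrite (is_tauY_dlog v H Vy) /formY.
have [_ VN _ _ _] := H; have Ny : NY y by exact: VN.
rewrite diff0_x2_incY // (diff0_has_diff v (has_diff_bY y)).
rewrite /aY /qY /pY.
by rewrite !(diff0_coord (n := 3)).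
Qed.

Lemma diff1_Theta1 x v w : N x ->
  diff1 (Theta1 x1 x2) x v w = - (twopii R)^-1 * wedge (diff0 x1) (diff0 x2) x v w.
Proof. by move=> Nx; exact: diff1_mul_diff0 oN hx1 hx2 Nx. Qed.

End JoyceTau.

(** * The Painleve I tau-function *)

Section PainleveTau.
Variable R : realType.
Local Notation C := (cplx R).

Definition dHL (y v : 'rV[C]_3) : C :=
  pL y * pL v - 6 * qL y ^+ 2 * qL v - tL y * qL v - qL y * tL v.

Lemma has_diff_HL (y : 'rV[C]_3) : has_diff (@HL R) y (dHL y).
Proof.
apply: has_diff_eq; first by rewrite /HL /tL /qL /pL; has_diff_tac.
by move=> v; rewrite /dHL /tL /qL /pL /=; field.
Qed.

Lemma dt_qL : dt (@qL R) = @pL R.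
Proof. by apply/funext => y; rewrite /dt [LHS](diff0_coord (n := 3)) mxE. Qed.

Lemma dt_pL (y : 'rV[C]_3) : dt (@pL R) y = 6 * qL y ^+ 2 + tL y.
Proof. by rewrite /dt [LHS](diff0_coord (n := 3)) mxE. Qed.

(** The Hamiltonian varies along the flow only through its explicit dependence on t. *)
Lemma dt_HL (y : 'rV[C]_3) : dt (@HL R) y = - qL y.
Proof.
rewrite /dt (diff0_has_diff _ (has_diff_HL y)) /dHL.
have -> : tL (flowL y) = 1 by rewrite /tL mxE.
have -> : qL (flowL y) = pL y by rewrite {1}/qL mxE.
have -> : pL (flowL y) = 6 * qL y ^+ 2 + tL y by rewrite {1}/pL mxE.
ring.
Qed.

(** The bracket 4 t H_t + 3 q_t^2 - 2 q q_tt equals 6 H. *)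
Lemma omegaLE (y v : 'rV[C]_3) : omegaL y v
  = 2 * (HL y * tL v + 5^-1 * (4 * tL y * dHL y v + 3 * pL y * qL v
       - 2 * qL y * pL v - 6 * HL y * tL v)).
Proof.
rewrite /omegaL dt_qL dt_pL dt_HL (diff0_has_diff v (has_diff_HL y)).
have -> : diff0 (@tL R) y v = tL v by exact: (diff0_coord (n := 3)).
have -> : diff0 (@qL R) y v = qL v by exact: (diff0_coord (n := 3)).
have -> : diff0 (@pL R) y v = pL v by exact: (diff0_coord (n := 3)).
by rewrite /HL; field.
Qed.

Section Tau.
Variables (L : set 'rV[C]_3) (nu1 nu2 : 'rV[C]_3 -> C).
Hypothesis mon : monodromy_coordinates L nu1 nu2.

Let oL : open L. Proof. by have [] := mon. Qed.
Let h1 : holomorphic L nu1. Proof. by have [] := mon. Qed.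
Let h2 : holomorphic L nu2. Proof. by have [] := mon. Qed.

Definition formL : form1 R 3 := fun y v =>
  2^-1 * omegaL y v - twopii R * nu1 y * diff0 nu2 y v.

Lemma formL_linear y : linear (formL y).
Proof.
move=> a u v; rewrite /formL !omegaLE.
have l : diff0 nu2 y (a *: u + v) = a * diff0 nu2 y u + diff0 nu2 y v.
  exact: linearP.
rewrite l /dHL /tL /qL /pL !mxE /GRing.scale /=.
move: (diff0 nu2 y u) (diff0 nu2 y v) (nu1 y) (HL y) => d1 d2 d3 d4.
ring.
Qed.

Lemma holomorphic_omegaL v : holomorphic L (fun y => omegaL y v).
Proof.
move=> k; have -> : (fun y => omegaL y v) = (fun y =>
   2 * (HL y * tL v + 5^-1 * (4 * tL y * dHL y v + 3 * pL y * qL v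
       - 2 * qL y * pL v - 6 * HL y * tL v))).
  by apply/funext => y; rewrite omegaLE.
have hH : holomorphic_upto k L (@HL R).
  by rewrite /HL /tL /qL /pL; holomorphic_tac oL.
have hdH : holomorphic_upto k L (fun y => dHL y v).
  by rewrite /dHL /tL /qL /pL; holomorphic_tac oL.
rewrite /tL /qL /pL.
by repeat first
  [ exact: hH | exact: hdH | exact: holomorphic_cst | exact: holomorphic_coord
  | apply: (holomorphicD oL) | apply: (holomorphicN oL) | apply: (holomorphicM oL) ].
Qed.

Lemma holomorphic_nu v : holomorphic L (fun y => twopii R * nu1 y * diff0 nu2 y v).
Proof.
move=> k; apply: (holomorphicM oL); first by apply: (holomorphicZ _ oL); exact: h1.
exact: holomorphic_diff0 h2 k.
Qed.

Lemma formL_holomorphic v : holomorphic L (fun y => formL y v).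
Proof.
move=> k; rewrite /formL; apply: (holomorphicD oL).
  by apply: (holomorphicZ _ oL); exact: holomorphic_omegaL.
by apply: (holomorphicN oL); exact: holomorphic_nu.
Qed.

(** The normalisation d omega = 4 pi i d nu_1 wedge d nu_2 makes the derivatives of the two
    terms equal. *)
Lemma formL_closed y v w : L y -> diff1 formL y v w = 0.
Proof.
move=> Ly; have [_ _ _ _ /(_ y Ly v w) dom] := mon.
have Dom u : has_diff (fun y => omegaL y u) y (diff0 (fun y => omegaL y u) y).
  exact: holomorphic_has_diff (holomorphic_omegaL u) Ly.
have Dnu u : has_diff (fun y => twopii R * nu1 y * diff0 nu2 y u) y
    (diff0 (fun y => twopii R * nu1 y * diff0 nu2 y u) y).
  exact: holomorphic_has_diff (holomorphic_nu u) Ly.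
have Dhalf u : has_diff (fun y => 2^-1 * omegaL y u) y
    (fun z => 2^-1 * diff0 (fun y => omegaL y u) y z).
  apply: has_diff_eq; first exact: has_diffM (has_diff_cst _ _) (Dom u).
  by move=> z /=; rewrite mulr0 addr0.
have D u : has_diff (fun y => formL y u) y _ := has_diffD (Dhalf u) (has_diffN (Dnu u)).
have dnu : diff1 (fun y v => twopii R * nu1 y * diff0 nu2 y v) y v w
    = twopii R * wedge (diff0 nu1) (diff0 nu2) y v w.
  rewrite -(diff1_mul_diff0 (twopii R) v w oL h1 h2 Ly).
  by congr (diff1 _ _ _ _); apply/funext => z; apply/funext => u; rewrite mulrA.
rewrite (diff1_has_diff (D w) (D v)).
have alg (a b c d o wd tp : C) : a - b = o -> c - d = tp * wd -> o = 2 * tp * wd ->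
    2^-1 * a - c - (2^-1 * b - d) = 0.
  move=> H1 H2 H3.
  have -> : 2^-1 * a - c - (2^-1 * b - d) = 2^-1 * (a - b) - (c - d) by ring.
  by rewrite H1 H2 H3; field.
exact: (alg _ _ _ _ _ _ _ (erefl _) dnu dom).
Qed.

Lemma tauL_defined : defined_up_to_constant L (is_tauL L nu1 nu2).
Proof.
split=> [y Ly|V tau tau' cV [oV _ htau tau0 H] [_ _ htau' tau0' H']].
  have [V [tau [[Vy cV oV VL] [htau tau0 dtau]]]] := exists_dlog_primitive oL Ly
    formL_linear formL_holomorphic (fun y Ly v w => formL_closed v w Ly).
  by exists V, tau; split.
apply: dlog_unique => //.
- by move=> y Vy; split; [exact: holomorphic_diff (htau 0) _ Vy|exact: tau0].
- by move=> y Vy; split; [exact: holomorphic_diff (htau' 0) _ Vy|exact: tau0'].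
- by move=> y Vy v; rewrite H // H'.
Qed.

End Tau.

Lemma HL_identL (y : 'rV[C]_3) : HL (identL y) = 2 * bY y.
Proof. by rewrite /HL tL_identL qL_identL pL_identL bYE; field. Qed.

(** The polynomial part of the tau-form of Y at eps = 1/2. *)
Lemma omegaL_identL (y v : 'rV[C]_3) : 2^-1 * omegaL (identL y) (identL v)
  = (2^-1 : C) ^- 2 * (- (6 * bY y / 5) * v 0 0 + 4 * y 0 0 / 5 * dbY y v + bY y * v 0 0)
    + (2^-1)^-1 * (2 * y 0 1 / 5 * v 0 2 - 3 * y 0 2 / 5 * v 0 1).
Proof.
rewrite omegaLE HL_identL /dHL !tL_identL !qL_identL !pL_identL /dbY.
by field.
Qed.

End PainleveTau.

(** * Comparison of the two tau-functions *)

Section Comparison.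
Variable R : realType.
Local Notation C := (cplx R).

Lemma diff_identL (y v : 'rV[C]_3) : 'd (@identL R) y v = identL v.
Proof. exact: (congr1 (fun h => h v) (linear_is_diff y (@identL_linear R)).2). Qed.

Variables (eps : C) (N : set 'rV[C]_4) (x1 x2 : 'rV[C]_4 -> C).
Variables (L : set 'rV[C]_3) (nu1 nu2 : 'rV[C]_3 -> C).
Hypotheses (fg : fg_coordinates eps N x1 x2) (half : eps = 2^-1).
Hypotheses (mon : monodromy_coordinates L nu1 nu2) (mat : matched N x1 x2 L nu1 nu2).
Variables (V : set 'rV[C]_3) (tau tauL : 'rV[C]_3 -> C).
Hypothesis HtauY : is_tauY eps N (@Theta0 R) (@ThetaI R) (Theta1 x1 x2) V tau.
Hypothesis HtauL : is_tauL L nu1 nu2 (@identL R @` V) tauL.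

(** The matching of co-ordinates holds on an open set, so it can be differentiated. *)
Lemma diff0_matched y v : V y ->
  diff0 x2 (incY y) (incY v) = - (twopii R * diff0 nu2 (identL y) (identL v)).
Proof.
move=> Vy; have [oV VN _ _ _] := HtauY; have [_ VL _ _ _] := HtauL.
have [_ _ _ hx2 _] := fg; have [_ _ hnu2 _ _] := mon.
have Dx : has_diff (fun y => x2 (incY y)) y (fun v => diff0 x2 (incY y) (incY v)).
  apply: has_diff_comp_linear; first exact: incY_linear.
  exact: holomorphic_has_diff hx2 (VN y Vy).
have LV z : V z -> L (identL z) by move=> Vz; apply: VL; exists z.
have Dn : has_diff (fun y => nu2 (identL y)) y (fun v => diff0 nu2 (identL y) (identL v)).
  apply: has_diff_comp_linear; first exact: identL_linear.
  exact: holomorphic_has_diff hnu2 (LV y Vy).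
have Dm := has_diffN (has_diffM (has_diff_cst (twopii R) y) Dn).
have E : \forall z \near y, x2 (incY z) = - (twopii R * nu2 (identL z)).
  apply: filterS (open_nbhs_nbhs (conj oV Vy)) => z Vz.
  by have [_ ->] := mat (VN z Vz) (LV z Vz).
have [_ dE] := diff_near_eq E Dx.1.
rewrite -(Dx.2 v); apply: etrans (esym (congr1 (fun h => h v) dE)) _.
by apply: etrans (Dm.2 v) _; rewrite mulr0 addr0.
Qed.

(** The polynomial parts agree by [omegaL_identL], and - 2 pi i nu_1 d nu_2 becomes
    x1 dx2 / (2 pi i) under the matching. *)
Lemma dlog_tau_eq y v : V y -> pull1 (@identL R) (dlog tauL) y v = dlog tau y v.
Proof.
move=> Vy; have [_ VN _ _ _] := HtauY; have [_ VL _ _ dtauL] := HtauL.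
have Wy : (@identL R @` V) (identL y) by exists y.
rewrite (is_tauY_dlog fg v HtauY Vy) /pull1 diff_identL dtauL // omegaL_identL /formY.
have [-> _] := mat (VN y Vy) (VL _ Wy).
rewrite diff0_matched // half.
have t0 := twopii_neq0 R.
congr (_ + _).
move: (nu1 _) (diff0 _ _ _) (twopii R) t0 => n1 n2 t t0.
by field; rewrite t0.
Qed.

Lemma tau_eq : connected V ->
  exists2 c : C, c != 0 & forall y, V y -> tauL (identL y) = c * tau y.
Proof.
move=> cV; have [oV _ htau tau0 _] := HtauY; have [_ _ htauL tauL0 _] := HtauL.
have W y : V y -> (@identL R @` V) (identL y) by move=> Vy; exists y.
have D y : V y -> has_diff (fun y => tauL (identL y)) y
    (fun v => diff0 tauL (identL y) (identL v)).
  move=> Vy; apply: has_diff_comp_linear; first exact: identL_linear.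
  exact: holomorphic_has_diff htauL (W y Vy).
apply: (@dlog_unique R 3 V tau (fun y => tauL (identL y))) => //.
- by move=> y Vy; split; [exact: holomorphic_diff (htau 0) _ Vy|exact: tau0].
- by move=> y Vy; split; [exact: (D y Vy).1|exact/tauL0/W].
- move=> y Vy v; rewrite -(dlog_tau_eq v Vy) /pull1 diff_identL /dlog.
  by rewrite (diff0_has_diff v (D y Vy)).
Qed.

End Comparison.

Theorem mainTheorem6 (R : realType) (eps : cplx R) (N : set 'rV[cplx R]_4)
    (x1 x2 : 'rV[cplx R]_4 -> cplx R) (eps_neq0 : eps != 0)
    (fgN : fg_coordinates eps N x1 x2) :
  let isTau := is_tauY eps N (@Theta0 R) (@ThetaI R) (Theta1 x1 x2) in
  [/\ (* the chosen 1-forms are symplectic potentials *)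
      (forall m, @Mset R m -> forall v w,
         diff1 (@Theta0 R) m v w = Omega0 m v w) /\
      (forall x, N x -> forall v w,
         diff1 (Theta1 x1 x2) x v w
         = - (twopii R)^-1 * wedge (diff0 x1) (diff0 x2) x v w),
      defined_up_to_constant (@incY R @^-1` N) isTau,
      forall V tau, isTau V tau -> forall y, V y -> forall v,
        dlog tau y v
        = eps ^- 2 * (- (6 * bY y / 5) * diff0 (@aY R) y v
                      + 4 * aY y / 5 * diff0 (@bY R) y v
                      + bY y * diff0 (@aY R) y v)
          + eps^-1 * (2 * qY y / 5 * diff0 (@pY R) y v
                      - 3 * pY y / 5 * diff0 (@qY R) y v)
          + (twopii R)^-1 * (x1 (incY y) * diff0 (x2 \o @incY R) y v)
    & eps = 2^-1 ->
      forall (L : set 'rV[cplx R]_3) (nu1 nu2 : 'rV[cplx R]_3 -> cplx R),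
        monodromy_coordinates L nu1 nu2 -> matched N x1 x2 L nu1 nu2 ->
        [/\ forall y : 'rV[cplx R]_3, HL (identL y) = 2 * bY y,
            defined_up_to_constant L (is_tauL L nu1 nu2)
          & forall V tau tauL,
              isTau V tau -> is_tauL L nu1 nu2 (@identL R @` V) tauL ->
              (forall y, V y -> forall v,
                 pull1 (@identL R) (dlog tauL) y v = dlog tau y v) /\
              (connected V -> exists2 c : cplx R, c != 0 &
                 forall y, V y -> tauL (identL y) = c * tau y)]].
Proof.
move=> isTau; split.
- split=> [m _ v w|x Nx v w]; first exact: diff1_Theta0.
  exact: (diff1_Theta1 fgN v w Nx).
- exact: tauY_defined fgN.
- by move=> V tau H y Vy v; exact: (is_tauY_formula fgN v H Vy).
move=> half L nu1 nu2 mon mat; split.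
- exact: HL_identL.
- exact: tauL_defined mon.
move=> V tau tauL HY HL; split.
  by move=> y Vy v; exact: (dlog_tau_eq fgN half mon mat HY HL v Vy).
move=> cV; exact: (tau_eq fgN half mon mat HY HL cV).
Qed.
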